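(* (Metrisation Theorem.) Let $P$ be a locally $A$-hyperdefinable set of countable cofinality. Then $P$ with the $A$-logic topology is pseudo-metrisable if and only if each piece (with its $A$-logic topology) is pseudo-metrisable. In particular, $P$ with the $A$-logic topology is pseudo-metrisable if $\mathcal{L}$ and $A$ are countable.
   Context: Fix a first-order many-sorted language $\mathcal{L}$ and a $\kappa$-saturated, strongly $\kappa$-homogeneous $\mathcal{L}$-structure $\mathfrak{M}$, with $\kappa>|\mathcal{L}|$ a strong limit cardinal; ''small'' means of cardinality $<\kappa$. A hyperdefinable set is a quotient $P=X/E$ of a nonempty type-definable set by a type-definable equivalence relation. $A$ is a small set of hyperimaginaries; $P$ is $A$-hyperdefinable if $X,E$ are $\mathrm{Aut}(\mathfrak{M}/A)$-invariant; a subset of $P$ is $\bigwedge_A$-definable if its preimage in $X$ is type-definable and $\mathrm{Aut}(\mathfrak{M}/A)$-invariant. A piecewise $A$-hyperdefinable set is a direct limit $P=\varinjlim_{i\in I}P_i$ of a directed system of $A$-hyperdefinable sets with injective $\bigwedge_A$-definable transition maps, $\mathrm{cf}(I)<\kappa$; the $P_i$ are the pieces, and the cofinality of $P$ is that of $I$. $V\subseteq P$ is piecewise $\bigwedge_A$-definable if each $V\cap P_i$ is $\bigwedge_A$-definable, and $\bigwedge_A$-definable if moreover in a piece. The $A$-logic topology on $P$ (and on each piece) has as closed sets the piecewise $\bigwedge_A$-definable sets. $P$ is locally $A$-hyperdefinable if every point has an $\bigwedge_A$-definable neighbourhood in the $A$-logic topology.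
   Formalization: In the last sentence, the tuples underlying each piece and each hyperimaginary in A are assumed to be of finite or countable length; for uncountable tuples it fails, e.g. for all ω₁-tuples in a structure with one infinite coinfinite unary predicate and A empty. *)

(* Defs.v *)
From mathcomp Require Import all_boot all_order all_algebra.
From mathcomp Require Import all_classical all_reals.

Set Implicit Arguments.
Unset Strict Implicit.
Unset Printing Implicit Defensive.

Import Order.TTheory GRing.Theory Num.Theory.
Local Open Scope classical_set_scope.
Local Open Scope card_scope.

Record language := Language {
  lsort : Type;
  lfun : Type;
  fun_arity : lfun -> nat;
  fun_dom : forall f : lfun, 'I_(fun_arity f) -> lsort;
  fun_cod : lfun -> lsort;
  lrel : Type;
  rel_arity : lrel -> nat;
  rel_dom : forall r : lrel, 'I_(rel_arity r) -> lsort
}.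

(* A context [sv : V -> lsort L] is a set [V] of variables, possibly infinite,
   each with its sort.  Quantifying over a variable of sort [s] binds the
   variable [None] of the context [sort_cons s sv] on [option V]. *)
Definition sort_cons (S V : Type) (s : S) (sv : V -> S) : option V -> S :=
  fun o => if o is Some v then sv v else s.

Definition sort_cat (S V W : Type) (sv : V -> S) (sw : W -> S) : V + W -> S :=
  fun u => match u with inl v => sv v | inr w => sw w end.

Inductive term (L : language) (V : Type) (sv : V -> lsort L) :
    lsort L -> Type :=
| Var : forall v : V, term sv (sv v)
| App : forall f : lfun L,
    (forall i : 'I_(fun_arity f), term sv (@fun_dom L f i)) ->
    term sv (fun_cod f).

Inductive formula (L : language) (V : Type) (sv : V -> lsort L) : Type :=
| FEq : forall s : lsort L, term sv s -> term sv s -> formula sv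
| FRel : forall r : lrel L,
    (forall i : 'I_(rel_arity r), term sv (@rel_dom L r i)) -> formula sv
| FBot : formula sv
| FImp : formula sv -> formula sv -> formula sv
| FAll : forall s : lsort L, formula (sort_cons s sv) -> formula sv.

Record structure (L : language) := Structure {
  carrier :> lsort L -> Type;
  fun_interp : forall f : lfun L,
    (forall i : 'I_(fun_arity f), carrier (@fun_dom L f i)) ->
    carrier (fun_cod f);
  rel_interp : forall r : lrel L,
    (forall i : 'I_(rel_arity r), carrier (@rel_dom L r i)) -> Prop
}.

Definition mtuple (L : language) (M : structure L) (V : Type)
  (sv : V -> lsort L) : Type := forall v : V, M (sv v).

Section Tuples.
Context (L : language) (M : structure L).

Definition tcons (V : Type) (sv : V -> lsort L) (s : lsort L)
    (a : M s) (x : mtuple M sv) : mtuple M (sort_cons s sv) :=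
  fun o => match o return M (sort_cons s sv o) with
           | Some v => x v
           | None => a
           end.

Context (V W : Type) (sv : V -> lsort L) (sw : W -> lsort L).

Definition tcat (x : mtuple M sv) (y : mtuple M sw) :
    mtuple M (sort_cat sv sw) :=
  fun u => match u return M (sort_cat sv sw u) with
           | inl v => x v
           | inr w => y w
           end.

Definition tleft (z : mtuple M (sort_cat sv sw)) : mtuple M sv :=
  fun v => z (inl v).

Definition tright (z : mtuple M (sort_cat sv sw)) : mtuple M sw :=
  fun w => z (inr w).

End Tuples.

Fixpoint eval (L : language) (M : structure L) (V : Type)
    (sv : V -> lsort L) (x : mtuple M sv) (s : lsort L) (t : term sv s) : M s :=
  match t in term _ s return M s with
  | Var v => x v
  | App f args => @fun_interp L M f (fun i => eval x (args i))
  end.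

Fixpoint sat (L : language) (M : structure L) (V : Type)
    (sv : V -> lsort L) (phi : formula sv) : mtuple M sv -> Prop :=
  match phi with
  | FEq _ t u => fun x => eval x t = eval x u
  | FRel r args => fun x => @rel_interp L M r (fun i => eval x (args i))
  | FBot => fun _ => False
  | FImp phi1 phi2 => fun x => sat phi1 x -> sat phi2 x
  | FAll s psi => fun x => forall a : M s, sat psi (tcons a x)
  end.

Record automorphism (L : language) (M : structure L) := Automorphism {
  aut_map :> forall s : lsort L, M s -> M s;
  aut_bij : forall s : lsort L, bijective (@aut_map s);
  aut_fun : forall (f : lfun L)
      (a : forall i : 'I_(fun_arity f), M (@fun_dom L f i)),
    aut_map (fun_interp a) = fun_interp (fun i => aut_map (a i));
  aut_rel : forall (r : lrel L)
      (a : forall i : 'I_(rel_arity r), M (@rel_dom L r i)),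
    rel_interp a <-> rel_interp (fun i => aut_map (a i))
}.

Definition act (L : language) (M : structure L) (g : automorphism M)
  (V : Type) (sv : V -> lsort L) (x : mtuple M sv) : mtuple M sv :=
  fun v => g _ (x v).
Arguments act {L M} g {V sv} x.

(* The cardinal kappa is represented by a type [K] of that cardinality. *)
Definition small (K T : Type) (D : set T) : Prop :=
  D #<= [set: K] /\ ~ ([set: K] #<= D).

Definition strong_limit (K : Type) : Prop :=
  forall T : Type, small K [set: T] -> small K [set: set T].

(* |L| is the number of L-formulas, hence the summand [nat]. *)
Definition language_small (K : Type) (L : language) : Prop :=
  small K [set: (lsort L + lfun L + lrel L + nat)%type].

Definition language_countable (L : language) : Prop :=
  countable [set: (lsort L + lfun L + lrel L)%type].

(* Every 1-type over a small tuple of parameters is realised; the parameters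
   are the variables [Some _], the variable of the type is [None]. *)
Definition saturated (K : Type) (L : language) (M : structure L) : Prop :=
  forall (B : Type) (sb : B -> lsort L) (b : mtuple M sb) (s : lsort L)
    (p : set (formula (sort_cons s sb))),
  small K [set: B] ->
  (forall q : set (formula (sort_cons s sb)), finite_set q -> q `<=` p ->
    exists a : M s, forall phi, q phi -> sat phi (tcons a b)) ->
  exists a : M s, forall phi, p phi -> sat phi (tcons a b).

(* Every partial elementary map [b i |-> c i] with small domain extends to an
   automorphism. *)
Definition strongly_homogeneous (K : Type) (L : language) (M : structure L) :
    Prop :=
  forall (B : Type) (sb : B -> lsort L) (b c : mtuple M sb),
  small K [set: B] ->
  (forall phi : formula sb, sat phi b <-> sat phi c) ->
  exists g : automorphism M, act g b = c.

Section TypeDefinable.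
Context (K : Type) (L : language) (M : structure L).
Context (V : Type) (sv : V -> lsort L).

Definition type_definable (X : set (mtuple M sv)) : Prop :=
  exists (B : Type) (sb : B -> lsort L) (b : mtuple M sb)
    (Gamma : set (formula (sort_cat sv sb))),
  small K [set: B] /\
  X = [set x | forall phi, Gamma phi -> sat phi (tcat x b)].

Definition type_definable0 (X : set (mtuple M sv)) : Prop :=
  exists Gamma : set (formula sv),
  X = [set x | forall phi, Gamma phi -> sat phi x].

End TypeDefinable.

Definition graph_of (L : language) (M : structure L)
    (V W : Type) (sv : V -> lsort L) (sw : W -> lsort L)
    (E : mtuple M sv -> set (mtuple M sw)) : set (mtuple M (sort_cat sv sw)) :=
  [set z | E (tleft z) (tright z)].

(* X / E, where E is a subset of X * X, given as the map x |-> E x. *)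
Record hyperdefinable (K : Type) (L : language) (M : structure L) :=
  Hyperdefinable {
  arity : Type;
  asort : arity -> lsort L;
  hdom : set (mtuple M asort);
  hrel : mtuple M asort -> set (mtuple M asort);
  arity_small : small K [set: arity];
  hdom_nonempty : hdom !=set0;
  hdom_type_definable : type_definable K hdom;
  hrel_type_definable : type_definable K (graph_of hrel);
  hrel_dom : forall x y, hrel x y -> hdom x /\ hdom y;
  hrel_refl : forall x, hdom x -> hrel x x;
  hrel_sym : forall x y, hrel x y -> hrel y x;
  hrel_trans : forall x y z, hrel x y -> hrel y z -> hrel x z
}.

Arguments asort {K L M} _ _.
Arguments hrel {K L M} _ _ _.
Arguments hdom {K L M} _ _.

(* The points of X / E are the E-classes, as subsets of X; so [\val p x] says
   that [p] is the class of [x]. *)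
Definition points (K : Type) (L : language) (M : structure L)
  (P : hyperdefinable K M) : Type := set_type (hrel P @` hdom P).
Coercion points : hyperdefinable >-> Sortclass.

Definition hclass (K : Type) (L : language) (M : structure L)
  (P : hyperdefinable K M) (p : P) : set (mtuple M (asort P)) := \val p.

(* A class of a relation E that is type-definable without parameters, so that
   automorphisms permute the E-classes. *)
Record hyperimaginary (K : Type) (L : language) (M : structure L) :=
  Hyperimaginary {
  hi_set : hyperdefinable K M;
  hi_dom0 : type_definable0 (hdom hi_set);
  hi_hrel0 : type_definable0 (graph_of (hrel hi_set));
  hi_point : hi_set
}.

Section OverA.
Context (K : Type) (L : language) (M : structure L).
(* The set A of hyperimaginaries, as a family indexed by [J]. *)
Context (J : Type) (A : J -> hyperimaginary K M).

Definition fixes (g : automorphism M) : Prop :=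
  forall j : J, act g @` hclass (hi_point (A j)) = hclass (hi_point (A j)).

Definition aut_invariant (V : Type) (sv : V -> lsort L) (X : set (mtuple M sv)) :
    Prop :=
  forall g : automorphism M, fixes g -> act g @` X = X.

Definition hyperdefinable_over (P : hyperdefinable K M) : Prop :=
  aut_invariant (hdom P) /\ aut_invariant (graph_of (hrel P)).

Definition hpreim (P : hyperdefinable K M) (W : set P) :
    set (mtuple M (asort P)) :=
  \bigcup_(p in W) hclass p.

(* [bw] stands for the bigwedge of bigwedge_A-definable. *)
Definition bw_definable (P : hyperdefinable K M) (W : set P) : Prop :=
  type_definable K (hpreim W) /\ aut_invariant (hpreim W).

(* The graph of [f], as a subset of the A-hyperdefinable set P * Q, is
   bigwedge_A-definable; its preimage is written out below. *)
Definition bw_definable_map (P Q : hyperdefinable K M) (f : P -> Q) : Prop :=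
  let G := [set z : mtuple M (sort_cat (asort P) (asort Q)) |
    exists p : P, hclass p (tleft z) /\ hclass (f p) (tright z)] in
  type_definable K G /\ aut_invariant G.

Record piecewise_hyperdefinable := PiecewiseHyperdefinable {
  pw_index : Type;
  ile : pw_index -> pw_index -> Prop;
  ile_refl : forall i, ile i i;
  ile_trans : forall i j k, ile i j -> ile j k -> ile i k;
  pw_inhabited : inhabited pw_index;
  ile_directed : forall i j, exists k, ile i k /\ ile j k;
  pw_cofinality : exists C : set pw_index,
    small K C /\ forall i, exists2 j, C j & ile i j;
  piece : pw_index -> hyperdefinable K M;
  piece_over : forall i, hyperdefinable_over (piece i);
  transition : forall i j, ile i j -> piece i -> piece j;
  transition_inj : forall i j (h : ile i j), injective (transition h);
  transition_definable : forall i j (h : ile i j), bw_definable_map (transition h);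
  transition_id : forall i (h : ile i i) x, transition h x = x;
  transition_comp : forall i j k (h : ile i j) (h' : ile j k) (h'' : ile i k) x,
    transition h' (transition h x) = transition h'' x
}.

Section Limit.
Context (P : piecewise_hyperdefinable).

Definition lim_eq (u : {i : pw_index P & piece i}) : set {i : pw_index P & piece i} :=
  [set v | exists (k : pw_index P) (hu : ile (projT1 u) k) (hv : ile (projT1 v) k),
    transition hu (projT2 u) = transition hv (projT2 v)].

Definition limit : Type := set_type (range lim_eq).

Definition lim_in (i : pw_index P) (x : piece i) : limit :=
  exist _ (lim_eq (existT _ i x))
    (mem_set (imageP lim_eq (I : [set: {i : pw_index P & piece i}] _))).

Definition piecewise_bw_definable (W : set limit) : Prop :=
  forall i : pw_index P, bw_definable (@lim_in i @^-1` W).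

Definition bw_definable_lim (W : set limit) : Prop :=
  piecewise_bw_definable W /\ exists i : pw_index P, W `<=` range (@lim_in i).

(* The A-logic topology on P and on a hyperdefinable set (in particular on each
   piece), given by its closed sets. *)
Definition logic_closed : set (set limit) := piecewise_bw_definable.

Definition logic_nbhd (p : limit) (N : set limit) : Prop :=
  exists U : set limit, [/\ logic_closed (~` U), U p & U `<=` N].

Definition locally_hyperdefinable : Prop :=
  forall p : limit, exists N : set limit, bw_definable_lim N /\ logic_nbhd p N.

Definition countable_cofinality : Prop :=
  exists C : set (pw_index P), countable C /\ forall i, exists2 j, C j & ile i j.

End Limit.

Definition piece_logic_closed (Q : hyperdefinable K M) : set (set Q) :=
  @bw_definable Q.

End OverA.

Arguments pw_index {K L M J A} _.
Arguments piece {K L M J A} _ _.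
Arguments logic_closed {K L M J A} _ _.
Arguments piece_logic_closed {K L M J} _ _ _.

(* [closed] is the family of closed sets of a topology on [T]. *)
Definition pseudo_metrisable (R : realType) (T : Type) (closed : set (set T)) :
    Prop :=
  exists d : T -> T -> R,
  [/\ forall x y, (0 <= d x y)%R,
      forall x, d x x = 0%R,
      forall x y, d x y = d y x,
      forall x y z, (d x z <= d x y + d y z)%R &
      forall F : set T, closed F <->
        (forall x, (~` F) x ->
          exists2 e : R, (0 < e)%R & [set y | (d x y < e)%R] `<=` ~` F)].

(* Main.v *)
Require Import Defs.
From Stdlib Require List.
From mathcomp Require Import all_boot all_order all_algebra.
From mathcomp Require Import all_classical all_reals.
From mathcomp Require Import lra.

(* Each piece embeds in the limit as a closed subspace, because projections of
   type-definable sets are type-definable by saturation.  This gives the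
   restriction of a pseudo-metric to the pieces.

   Conversely, let d_n metrise the n-th member Q_n of a countable cofinal family
   of pieces, and let g_n(x) be the d_n-distance from x to the complement of the
   interior of Q_n.  Since Q_n is closed, r_n = min(d_n, g_n(x) + g_n(y)) extends
   continuously to the limit, and it induces the right topology on the interior
   of Q_n.  By local hyperdefinability the interiors cover, so that
   sup_n min(1/(n+1), r_n) metrises the limit; no compactness is needed.

   In the countable case represent A by a countable real tuple a.  On a piece
   X/E the orbit relation of Aut(M/A) is type-definable and Aut(M/a)-invariant,
   hence, by homogeneity, an intersection of countably many a-definable relations.
   By compactness they form a base of a uniformity, which the chain metric
   metrises.  A set F that is closed for it is type-definable over a: a point x
   outside F lies in an a-definable set disjoint from F, since points with the
   same type over a are in the same orbit. *)

Set Implicit Arguments.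
Unset Strict Implicit.
Unset Printing Implicit Defensive.

Local Open Scope classical_set_scope.

(** * Small cardinals *)

Lemma card_leTTP (T U : Type) :
  ([set: T] #<= [set: U])%card <-> exists f : T -> U, injective f.
Proof.
split=> [/card_leP/injfunPex[f _ f_inj]|[f f_inj]].
  exists (fun x => set_val (f (to_setT x))) => x y /val_inj fxy.
  exact: (congr1 val (f_inj _ _ (mem_set I) (mem_set I) fxy)).
apply/card_leP/injfunPex; exists (to_setT \o f \o set_val) => // x y _ _.
by move=> /(congr1 val)/f_inj/val_inj.
Qed.

Lemma small_inj (K T U : Type) (f : T -> U) :
  injective f -> small K [set: U] -> small K [set: T].
Proof.
move=> f_inj [UK KU].
have TU : ([set: T] #<= [set: U])%card by apply/card_leTTP; exists f.
split; first exact: card_le_trans UK.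
by move=> KT; apply: KU; apply: card_le_trans TU.
Qed.

(* A maximal partial injective relation between [T] and [U] is total on one
   side. *)
Lemma inj_total (T U : Type) :
  (exists f : T -> U, injective f) \/ (exists f : U -> T, injective f).
Proof.
pose P (G : set (T * U)) := forall u v, G u -> G v ->
  (u.1 = v.1 <-> u.2 = v.2).
have [F FP F_chain|G [PG Gmax]] := @Zorn_bigcup _ P.
  move=> u v [X FX Xu] [Y FY Yv].
  have [XY|YX] := F_chain _ _ FX FY.
  - by apply: (FP _ FY) => //; exact: XY.
  - by apply: (FP _ FX) => //; exact: YX.
have [Gl|/existsNP[x Gx]] := EM (forall x, exists y, G (x, y)).
  have [f Gf] := choice Gl; left; exists f => x y fxy.
  by apply/(PG _ _ (Gf x) (Gf y)).
have [Gr|/existsNP[y Gy]] := EM (forall y, exists x, G (x, y)).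
  have [f Gf] := choice Gr; right; exists f => y1 y2 fxy.
  by apply/(PG _ _ (Gf y1) (Gf y2)).
exfalso; apply: (Gmax (G `|` [set (x, y)])).
  split; first by move=> u Gu; left.
  by move=> /(_ (x, y) (or_intror erefl)) Gxy; apply: Gx; exists y.
move=> [a b] [c d] [Gab|[-> ->]] [Gcd|[-> ->]] //=; first exact: PG Gab Gcd.
- split=> [ax|bd]; exfalso; first by apply: Gx; exists b; rewrite -ax.
  by apply: Gy; exists a; rewrite -bd.
- split=> [ax|bd]; exfalso; first by apply: Gx; exists d; rewrite ax.
  by apply: Gy; exists c; rewrite bd.
Qed.

(** Once [T] embeds in [U], the sum embeds in the double power set of [U], and two power sets stay
    below a strong limit. *)
Lemma small_sum (K T U : Type) : strong_limit K ->
  small K [set: T] -> small K [set: U] -> small K [set: (T + U)%type].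
Proof.
move=> K_lim.
wlog [f f_inj] : T U / exists f : T -> U, injective f.
  move=> sum; have [TU|UT] := inj_total T U; first exact: sum.
  move=> sT sU; pose swap (u : T + U) :=
    match u with inl t => inr t | inr t => inl t end.
  apply: (@small_inj _ _ (U + T)%type swap); last exact: sum.
  by move=> [a|a] [b|b] // [->].
(* The member [set0] marks the right summand; a singleton is never empty, so the two images are
   disjoint. *)
move=> _ sU; apply: (@small_inj _ _ (set (set U)) (fun u => match u with
  inl t => [set [set f t]] | inr t => [set [set t]; set0] end));
  last exact/K_lim/K_lim.
have sing0 (x : U) : [set x] <> set0.
  by move=> x0; have : [set x] x by []; rewrite x0.
move=> [a|a] [b|b] /seteqP[ab ba].
- congr inl; apply: f_inj; have /= fab := ab _ (erefl [set f a]).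
  have : [set f b] (f b) by [].
  by rewrite -fab.
- by have /= /esym/sing0 := ba _ (or_intror erefl).
- by have /= /esym/sing0 := ab _ (or_intror erefl).
- congr inr; case: (ab _ (or_introl erefl)) => [/= sab|/= /sing0//].
  by have : [set a] a by []; rewrite sab.
Qed.

Lemma small_countable (K T : Type) :
  small K [set: nat] -> countable [set: T] -> small K [set: T].
Proof.
move=> K_nat /card_leTTP[f f_inj]; exact: small_inj f_inj K_nat.
Qed.

(** * Renaming and finite support of formulas *)

Section Renaming.
Context (L : language) (M : structure L).

(** A renaming respects sorts only up to the equalities [H], so values are transported along
    them. *)
Definition pull (V W : Type) (sv : V -> lsort L) (sw : W -> lsort L)
    (rho : V -> W) (H : forall v, sw (rho v) = sv v) (y : mtuple M sw) :
    mtuple M sv :=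
  fun v => eq_rect _ M (y (rho v)) _ (H v).

Fixpoint trename (V W : Type) (sv : V -> lsort L) (sw : W -> lsort L)
    (rho : V -> W) (H : forall v, sw (rho v) = sv v) s (t : term sv s) :
    term sw s :=
  match t in term _ s return term sw s with
  | Var v => eq_rect _ (term sw) (Var sw (rho v)) _ (H v)
  | App f args => App (fun i => trename H (args i))
  end.

Lemma eval_trename (V W : Type) (sv : V -> lsort L) (sw : W -> lsort L)
    (rho : V -> W) (H : forall v, sw (rho v) = sv v) s (t : term sv s)
    (y : mtuple M sw) : eval y (trename H t) = eval (pull H y) t.
Proof.
elim: t => [v|f args IH] /=; first by rewrite /pull; case: _ / (H v).
by congr fun_interp; apply: functional_extensionality_dep => i.
Qed.

Definition sort_cons_rename (V W : Type) (sv : V -> lsort L) (sw : W -> lsort L)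
    (rho : V -> W) (H : forall v, sw (rho v) = sv v) (s : lsort L) :
    forall o, sort_cons s sw (omap rho o) = sort_cons s sv o :=
  fun o => match o with Some v => H v | None => erefl end.

(** The renaming is quantified after [phi] because [FAll] enlarges the context in the recursive
    call. *)
Fixpoint frename (V : Type) (sv : V -> lsort L) (phi : formula sv) :
    forall (W : Type) (sw : W -> lsort L) (rho : V -> W)
      (H : forall v, sw (rho v) = sv v), formula sw :=
  match phi with
  | FEq _ t u => fun W sw rho H => FEq (trename H t) (trename H u)
  | FRel r args => fun W sw rho H => FRel (fun i => trename H (args i))
  | FBot => fun W sw rho H => FBot sw
  | FImp phi psi => fun W sw rho H => FImp (frename phi H) (frename psi H)
  | FAll s psi => fun W sw rho H => FAll (frename psi (sort_cons_rename H s))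
  end.

Lemma sat_frename (V : Type) (sv : V -> lsort L) (phi : formula sv)
    (W : Type) (sw : W -> lsort L) (rho : V -> W)
    (H : forall v, sw (rho v) = sv v) (y : mtuple M sw) :
  sat (frename phi H) y <-> sat phi (pull H y).
Proof.
elim: phi W sw rho H y => {V sv}
  [V sv s t u|V sv r args|V sv|V sv phi IH1 psi IH2|V sv s psi IH] W sw rho H y
  //=.
- by rewrite !eval_trename.
- suff -> : (fun i => eval y (trename H (args i))) =
            (fun i => eval (pull H y) (args i)) by [].
  by apply: functional_extensionality_dep => i; rewrite eval_trename.
- by rewrite IH1 IH2.
- have pullE a : pull (sort_cons_rename H s) (tcons a y) = tcons a (pull H y).
    by apply: functional_extensionality_dep; case.
  by split=> psiA a; have := psiA a; rewrite IH pullE.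
Qed.

Lemma eval_support (V : Type) (sv : V -> lsort L) s (t : term sv s) :
  exists l : seq V, forall x y : mtuple M sv,
    (forall v, List.In v l -> x v = y v) -> eval x t = eval y t.
Proof.
elim: t => [v|f args /choice[l lP]] /=.
  by exists [:: v] => x y; apply; left.
exists (List.flat_map l (enum 'I_(fun_arity f))) => x y xy.
congr fun_interp; apply: functional_extensionality_dep => i.
apply: lP => v vl; apply: xy; apply/List.in_flat_map; exists i; split=> //.
have : i \in enum 'I_(fun_arity f) by rewrite mem_enum.
by elim: (enum _) => //= j e IH;
  rewrite in_cons => /orP[/eqP->|/IH]; [left|right].
Qed.

(** Contexts may be infinite but formulas are finite objects. This semantic support stands in for a
    list of free variables; [List.In] is used because variables carry no decidable equality. *)
Lemma sat_support (V : Type) (sv : V -> lsort L) (phi : formula sv) :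
  exists l : seq V, forall x y : mtuple M sv,
    (forall v, List.In v l -> x v = y v) -> sat phi x <-> sat phi y.
Proof.
elim: phi => {V sv}
  [V sv s t u|V sv r args|V sv|V sv phi [l lP] psi [l' lP']|V sv s psi [l lP]].
- have [l lP] := eval_support t; have [l' lP'] := eval_support u.
  exists (l ++ l') => x y xy /=.
  rewrite (lP x y) 1?(lP' x y) // => v vl; apply: xy; apply/List.in_or_app;
    by [left|right].
- have [l lP] := choice (fun i => eval_support (args i)).
  exists (List.flat_map l (enum 'I_(rel_arity r))) => x y xy /=.
  suff -> : (fun i => eval x (args i)) = (fun i => eval y (args i)) by [].
  apply: functional_extensionality_dep => i.
  apply: lP => v vl; apply: xy; apply/List.in_flat_map; exists i; split=> //.
  have : i \in enum 'I_(rel_arity r) by rewrite mem_enum.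
  by elim: (enum _) => //= j e IH;
    rewrite in_cons => /orP[/eqP->|/IH]; [left|right].
- by exists nil.
- exists (l ++ l') => x y xy /=.
  rewrite (lP x y) 1?(lP' x y) // => v vl; apply: xy; apply/List.in_or_app;
    by [left|right].
(* The bound variable [None] is dropped from the support of the body. *)
- exists (List.flat_map (fun o => if o is Some v then [:: v] else nil) l).
  move=> x y xy /=; suff lxy a : sat psi (tcons a x) <-> sat psi (tcons a y).
    by split=> + a => /(_ a); rewrite lxy.
  apply: lP => -[v|//] vl /=; apply: xy; apply/List.in_flat_map.
  by exists (Some v); split=> //; left.
Qed.

Definition upd (V : Type) (sv : V -> lsort L) (x : mtuple M sv) (v : V)
    (a : M (sv v)) : mtuple M sv :=
  fun u => match pselect (v = u) with
           | left e => eq_rect v (fun u => M (sv u)) a u e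
           | right _ => x u
           end.

Lemma upd_eq (V : Type) (sv : V -> lsort L) (x : mtuple M sv) v a :
  @upd V sv x v a v = a.
Proof.
rewrite /upd; case: pselect => [e|//].
by rewrite (Prop_irrelevance e erefl).
Qed.

Lemma upd_neq (V : Type) (sv : V -> lsort L) (x : mtuple M sv) v a u :
  v <> u -> @upd V sv x v a u = x u.
Proof. by rewrite /upd; case: pselect. Qed.

(** [FAll] binds only the fresh variable [None]; renaming [v] to [None] makes it possible to
    quantify over a variable of the context. *)
Lemma formula_unbind (V : Type) (sv : V -> lsort L) (v : V) (phi : formula sv) :
  exists psi : formula (sort_cons (sv v) sv),
    forall (a : M (sv v)) (x : mtuple M sv),
      sat psi (tcons a x) <-> sat phi (upd x a).
Proof.
pose rho u := match pselect (v = u) with left _ => None | right _ => Some u end.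
have H u : sort_cons (sv v) sv (rho u) = sv u.
  by rewrite /rho; case: pselect => // e; case: _ / e.
exists (frename phi H) => a x; rewrite sat_frename.
suff -> : pull H (tcons a x) = upd x a by [].
apply: functional_extensionality_dep => u; rewrite /pull /upd.
move: (H u); rewrite /rho; case: pselect => [e|e] h /=.
  by case: _ / e h => h; rewrite (Prop_irrelevance h erefl).
by rewrite (Prop_irrelevance h erefl).
Qed.

(** One quantifier is added per element of [l]. The variables of [l] remain in the context, but the
    truth of [psi] no longer depends on them. *)
Lemma sat_ex (V : Type) (sv : V -> lsort L) (l : seq V) (phi : formula sv) :
  exists psi : formula sv, forall x, sat psi x <->
    exists2 y : mtuple M sv, (forall v, ~ List.In v l -> y v = x v) & sat phi y.
Proof.
elim: l => [|v l [psi psiP]].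
  exists phi => x; split=> [|[y yx]]; first by exists x.
  suff -> : y = x by [].
  by apply: functional_extensionality_dep => v; exact: yx.
have [chi chiP] := formula_unbind v psi.
exists (FImp (FAll (FImp chi (FBot _))) (FBot _)) => x /=; split.
  move=> /existsNP[a /contrapT/chiP/psiP[y yx yphi]]; exists y => // u uvl.
  rewrite yx; first by rewrite upd_neq // => uv; apply: uvl; left.
  by move=> ul; apply: uvl; right.
move=> [y yx yphi] /(_ (y v)); apply; apply/chiP/psiP.
exists y => // u ul; have [vu|vu] := pselect (v = u).
  by case: _ / vu; rewrite upd_eq.
by rewrite upd_neq //; apply: yx => -[].
Qed.

End Renaming.

(** * Compactness *)

Lemma existT_inj (I : Type) (T : I -> Type) (i : I) (a b : T i) :
  existT T i a = existT T i b -> a = b.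
Proof.
by move=> ab; have /= := projT2_eq ab; rewrite (Prop_irrelevance (projT1_eq ab) erefl).
Qed.

Definition definable (L : language) (M : structure L) (V B : Type)
    (sv : V -> lsort L) (sb : B -> lsort L) (b : mtuple M sb) :
    set (set (mtuple M sv)) :=
  [set D | exists phi : formula (sort_cat sv sb),
    D = [set x | sat phi (tcat x b)]].

(** As [F] is closed under intersection and [Phi] is antitone, one member of [F] serves finitely
    many [t]. This supplies the finite satisfiability that saturation asks for. *)
Lemma finite_filter (T U : Type) (F : set (set U)) (Phi : set U -> set T)
    (q : set T) :
  finite_set q -> F !=set0 -> (forall D E, F D -> F E -> F (D `&` E)) ->
  (forall D E, E `<=` D -> Phi D `<=` Phi E) ->
  (forall t, q t -> exists2 D, F D & Phi D t) ->
  exists2 D, F D & q `<=` Phi D.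
Proof.
move=> /(@finite_seqP {classic T})[s ->] [D0 FD0] FI PhiS.
elim: s => [|t s IH] qP; first by exists D0.
have [D FD sD] : exists2 D, F D & [set` s] `<=` Phi D.
  by apply: IH => u /= us; apply: qP; rewrite /= in_cons us orbT.
have [E FE tE] := qP t (mem_head _ _).
exists (D `&` E); first exact: FI.
move=> u /=; rewrite in_cons => /orP[/eqP->|/sD].
  by apply: PhiS tE => x [].
by apply: PhiS => x [].
Qed.

Section Compactness.
Context (K : Type) (L : language) (M : structure L).
Context (K_lim : strong_limit K) (M_sat : saturated K M).

Section FilterBase.
Context (V B : Type) (sv : V -> lsort L) (sb : B -> lsort L) (b : mtuple M sb).
Context (F : set (set (mtuple M sv))).
Context (V_small : small K [set: V]) (B_small : small K [set: B]).
Context (F_definable : forall D, F D -> definable b D).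
Context (F_inter : forall D E, F D -> F E -> F (D `&` E)).
Context (F_nonempty : F !=set0).

Let agree (G : set {v & M (sv v)}) (y : mtuple M sv) :=
  forall v a, G (existT _ v a) -> y v = a.

(* Partial tuples, given by their graphs, that extend to a point of every
   member of [F]. *)
Let extendible (G : set {v & M (sv v)}) :=
  forall D, F D -> exists2 y, agree G y & D y.

(** The formula defining [D] sees finitely many variables, and the values that the union gives them
    already occur in one member of the chain. A point of [D] extending that member may be
    overwritten by the union without leaving [D]. *)
Let extendible_bigcup (C : set (set {v & M (sv v)})) :
  extendible set0 ->
  C `<=` extendible -> total_on C subset -> extendible (\bigcup_(G in C) G).
Proof.
move=> ext0 Cext Cchain D FD; set U := \bigcup_(G in C) G.
have U_fun v a a' : U (existT _ v a) -> U (existT _ v a') -> a = a'.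
  move=> [G CG Ga] [G' CG' Ga'].
  have [GG'|GG'] := Cchain _ _ CG CG'.
    by have [y Gy _] := Cext _ CG' _ FD; rewrite -(Gy _ a (GG' _ Ga)) (Gy _ a').
  by have [y Gy _] := Cext _ CG _ FD; rewrite -(Gy _ a Ga) (Gy _ a' (GG' _ Ga')).
have [phi phiP] := F_definable FD; have [l lP] := sat_support M phi.
have [G Gext GU] : exists2 G, extendible G & forall v a, List.In (inl v) l ->
    U (existT _ v a) -> G (existT _ v a).
  (* The alternative [set0] covers an empty chain and a support on which the union assigns
     nothing. *)
  suff [G [G0|CG] GU] : exists2 G, G = set0 \/ C G &
      forall v a, List.In (inl v) l -> U (existT _ v a) -> G (existT _ v a).
  - by exists G => //; rewrite G0.
  - by exists G => //; exact: Cext.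
  elim: (l) => [|u s [G CG GU]]; first by exists set0; [left|].
  case: u => [v|c]; last by exists G => // v a /= [//|]; exact: GU.
  have [[a [G' CG' G'a]]|Uv] := EM (exists a, U (existT _ v a)); last first.
    exists G => // w a /= [[vw]|]; last exact: GU.
    by subst w => Ua; case: Uv; exists a.
  have Ua : U (existT _ v a) by exists G'.
  have [GG'|G'G] : G `<=` G' \/ (C G /\ G' `<=` G).
  - case: CG => [->|CG]; first by left.
    by have [|] := Cchain _ _ CG CG'; [left|right].
  - exists G'; first by right.
    move=> w a' /= [[vw]|ws Ua']; last exact/GG'/GU.
    by subst w => /(U_fun _ _ _ Ua) <-.
  - exists G; first by right; case: G'G.
    move=> w a' /= [[vw]|ws Ua']; last exact/GU.
    by subst w => /(U_fun _ _ _ Ua) <-; case: G'G => _; apply.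
have [y Gy Dy] := Gext D FD.
pose y' v := match pselect (exists a, U (existT _ v a)) with
             | left e => projT1 (cid e) | right _ => y v end.
have Uy' : agree U y'.
  move=> v a Ua; rewrite /y'; case: pselect => [e|]; last by case; exists a.
  by case: cid => a' /= Ua'; apply: U_fun Ua.
exists y' => //; move: Dy; rewrite phiP /=.
apply: (iffLR (lP _ _ _)) => -[v|c] //= vl.
rewrite /y'; case: pselect => // e; case: cid => a /= Ua.
by apply: Gy; exact: GU.
Qed.

(** Saturation realises types in one variable, while [x] is a small, possibly infinite tuple. Zorn's
    lemma gives a maximal extendible partial tuple, and saturation over its values shows that it is
    total. *)
Lemma compactness : (forall D, F D -> D !=set0) -> exists x, forall D, F D -> D x.
Proof.
move=> F0; have ext0 : extendible set0.
  by move=> D FD; have [y Dy] := F0 D FD; exists y.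
have [C Cext Cchain|G [Gext Gmax]] := @Zorn_bigcup _ extendible.
  exact: extendible_bigcup.
have [D0 FD0] := F_nonempty.
suff G_total : forall v, exists a, G (existT _ v a).
  exists (fun v => projT1 (cid (G_total v))) => D FD.
  have [y Gy Dy] := Gext D FD; suff -> : (fun v => projT1 (cid (G_total v))) = y by [].
  apply: functional_extensionality_dep => v.
  by case: cid => a /= /Gy.
apply: contrapT => /existsNP[v Gv].
(* [y0] fills the unassigned coordinates of [G] arbitrarily, so that it can serve as a parameter
   tuple. *)
have [y0 Gy0 _] := Gext D0 FD0.
(* The type of a value for [v]: all formulas satisfied by the [v]-coordinate of every point of some
   [D] that extends [G]. *)
pose Phi D : set (formula (sort_cons (sv v) (sort_cat sv sb))) :=
  [set chi | forall y, agree G y -> D y -> sat chi (tcons (y v) (tcat y0 b))].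
have [q q_fin qP|a aP] := M_sat (b := tcat y0 b)
    (p := [set chi | exists2 D, F D & Phi D chi]) (small_sum K_lim V_small B_small).
  have [|D FD qD] := finite_filter (Phi := Phi) q_fin F_nonempty F_inter _ qP.
    by move=> D E ED chi Dchi y Gy /ED; exact: Dchi.
  have [y Gy Dy] := Gext D FD.
  by exists (y v) => chi /qD; apply.
apply: (Gmax (G `|` [set existT _ v a])).
  split; first by move=> u Gu; left.
  by move=> /(_ (existT _ v a) (or_intror erefl)) Ga; apply: Gv; exists a.
move=> D FD; have [phi phiP] := F_definable FD.
have [l lP] := sat_support M phi.
(* The variables other than [v] left open by [G]. Quantifying them away in [phi] gives a formula of
   the type, in which the arbitrary values of [y0] have no influence. *)
pose free (u : V + B) : bool := `[< if u is inl w then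
  v <> w /\ ~ exists a, G (existT _ w a) else False >].
have [psi psiP] := sat_ex M (List.filter free l) phi.
have [chi chiP] := formula_unbind M (inl v) psi.
have : sat chi (tcons a (tcat y0 b)).
  apply: aP; exists D => // y Gy Dy; apply/chiP/psiP.
  set z0 := upd _ _.
  pose z : mtuple M (sort_cat sv sb) := fun u =>
    if pselect (List.In u (List.filter free l)) then tcat y b u else z0 u.
  exists z; first by move=> u ul; rewrite /z; case: pselect.
  move: Dy; rewrite phiP /=; apply: (iffLR (lP _ _ _)) => u ul.
  rewrite /z; case: pselect => //= ufree.
  rewrite /z0; have [vu|vu] := pselect (inl v = u).
    by case: _ / vu {ul ufree}; rewrite upd_eq.
  rewrite upd_neq //; case: u => [w|//] in ul ufree vu *.
  rewrite /=; apply: contrapT => yw; apply: ufree.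
  apply/List.filter_In; split=> //; apply/asboolP; split=> [vw|[c Gc]].
    by apply: vu; rewrite vw.
  by apply: yw; rewrite (Gy _ c) // (Gy0 _ c).
move=> /chiP/psiP[z zP zphi]; exists (tleft z).
  move=> w c [Gc|/= vc].
    rewrite /tleft zP /=; last first.
      move=> /List.filter_In[_ /asboolP[_ []]]; by exists c.
    have vw : v <> w by move=> vw; subst w; apply: Gv; exists c.
    by rewrite upd_neq /= => [|-[]//]; exact: Gy0.
  have vw : w = v by case: vc.
  subst w; rewrite /tleft zP; last first.
    by move=> /List.filter_In[_ /asboolP[]].
  by rewrite upd_eq (existT_inj vc).
rewrite phiP /=; suff -> : tcat (tleft z) b = z by [].
apply: functional_extensionality_dep => -[w|c] //=; rewrite zP ?upd_neq //.
by move=> /List.filter_In[_ /asboolP].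
Qed.

End FilterBase.

End Compactness.

(** * Type-definable sets *)

(** Intersections of [p]-definable sets, with the family taken to be all [p]-definable supersets.
    Unlike in [type_definable], the parameter tuple is explicit and can be changed. *)
Definition type_closed (L : language) (M : structure L) (V B : Type)
    (sv : V -> lsort L) (sb : B -> lsort L) (p : mtuple M sb)
    (X : set (mtuple M sv)) : Prop :=
  forall x, (forall D, definable p D -> X `<=` D -> D x) -> X x.

Section Definable.
Context (L : language) (M : structure L).

Lemma act_tcat (g : automorphism M) (V W : Type) (sv : V -> lsort L)
    (sw : W -> lsort L) (x : mtuple M sv) (y : mtuple M sw) :
  act g (tcat x y) = tcat (act g x) (act g y).
Proof. by apply: functional_extensionality_dep; case. Qed.

Lemma tcat_inj (V W : Type) (sv : V -> lsort L) (sw : W -> lsort L)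
    (x x' : mtuple M sv) (y y' : mtuple M sw) :
  tcat x y = tcat x' y' -> x = x' /\ y = y'.
Proof. by move=> e; split; [have := congr1 (@tleft _ _ _ _ _ _) e|
  have := congr1 (@tright _ _ _ _ _ _) e]. Qed.

Lemma tcatE (V W : Type) (sv : V -> lsort L) (sw : W -> lsort L)
    (z : mtuple M (sort_cat sv sw)) : tcat (tleft z) (tright z) = z.
Proof. by apply: functional_extensionality_dep; case. Qed.

(* Each coordinate of [f y] is a coordinate of [y] or of [q], and likewise for
   the parameters [p]. *)
Definition substitution (V B W C : Type) (sv : V -> lsort L) (sb : B -> lsort L)
    (sw : W -> lsort L) (sc : C -> lsort L) (p : mtuple M sb) (q : mtuple M sc)
    (f : mtuple M sw -> mtuple M sv) : Prop :=
  forall u, exists w (e : sort_cat sw sc w = sort_cat sv sb u),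
    forall y, tcat (f y) p u = eq_rect _ M (tcat y q w) _ e.

Lemma definable_preimage (V B W C : Type) (sv : V -> lsort L)
    (sb : B -> lsort L) (sw : W -> lsort L) (sc : C -> lsort L)
    (p : mtuple M sb) (q : mtuple M sc) (f : mtuple M sw -> mtuple M sv)
    (D : set (mtuple M sv)) :
  substitution p q f -> definable p D -> definable q (f @^-1` D).
Proof.
move=> /choice[rho /(_ _)/cid rhoP] [phi ->].
exists (frename phi (fun u => projT1 (rhoP u))); apply/seteqP.
suff fE y : tcat (f y) p = pull (fun u => projT1 (rhoP u)) (tcat y q).
  by split=> y /=; rewrite sat_frename fE.
by apply: functional_extensionality_dep => u; rewrite /pull; case: (rhoP u).
Qed.

Context (V B : Type) (sv : V -> lsort L) (sb : B -> lsort L) (p : mtuple M sb).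
Implicit Types D E X Y : set (mtuple M sv).

Lemma definableC D : definable p D -> definable p (~` D).
Proof.
move=> [phi ->]; exists (FImp phi (FBot _)).
by apply/seteqP; split=> x h; exact: h.
Qed.

Lemma definableI D E : definable p D -> definable p E -> definable p (D `&` E).
Proof.
move=> [phi ->] [psi ->].
exists (FImp (FImp phi (FImp psi (FBot _))) (FBot _)); apply/seteqP.
split=> [x [xphi xpsi]|x /= h]; first by apply.
by split; apply: contrapT => n; apply: h.
Qed.

Lemma definableT : definable p [set: mtuple M sv].
Proof. by exists (FImp (FBot _) (FBot _)); apply/seteqP; split=> x _ //= []. Qed.

Lemma definable_imply D E : definable p D -> definable p E ->
  definable p [set x | D x -> E x].
Proof.
move=> [phi ->] [psi ->]; exists (FImp phi psi).
by apply/seteqP; split=> x h; exact: h.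
Qed.

Lemma definable_type_closed D : definable p D -> type_closed p D.
Proof. by move=> pD x; apply. Qed.

Lemma type_closed_bigcap (I : Type) (P : set I) (X : I -> set (mtuple M sv)) :
  (forall i, P i -> type_closed p (X i)) -> type_closed p (\bigcap_(i in P) X i).
Proof.
move=> XP x xP i Pi; apply: XP => // D pD XD; apply: xP => // y /(_ i Pi).
exact: XD.
Qed.

Lemma type_closedI X Y :
  type_closed p X -> type_closed p Y -> type_closed p (X `&` Y).
Proof.
move=> pX pY x xP; split; [apply: pX|apply: pY] => D pD XD; apply: xP => //.
  by move=> y [/XD].
by move=> y [_ /XD].
Qed.

End Definable.

Lemma type_closed_preimage (L : language) (M : structure L) (V B W C : Type)
    (sv : V -> lsort L) (sb : B -> lsort L) (sw : W -> lsort L)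
    (sc : C -> lsort L) (p : mtuple M sb) (q : mtuple M sc)
    (f : mtuple M sw -> mtuple M sv) (X : set (mtuple M sv)) :
  substitution p q f -> type_closed p X -> type_closed q (f @^-1` X).
Proof.
move=> fP pX y yP; apply: pX => D pD XD.
by apply: (yP (f @^-1` D)); [exact: definable_preimage pD|move=> z /XD].
Qed.

Lemma type_definableP (K : Type) (L : language) (M : structure L) (V : Type)
    (sv : V -> lsort L) (X : set (mtuple M sv)) :
  type_definable K X <-> exists (B : Type) (sb : B -> lsort L) (b : mtuple M sb),
    small K [set: B] /\ type_closed b X.
Proof.
split=> [[B [sb [b [Gamma [B_small ->]]]]]|[B [sb [b [B_small bX]]]]].
  exists B, sb, b; split=> // x xP phi Gphi.
  by apply: (xP [set x | sat phi (tcat x b)]) => [|y]; [exists phi|apply].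
exists B, sb, b, [set phi | X `<=` [set x | sat phi (tcat x b)]]; split=> //.
apply/seteqP; split=> [x Xx phi /(_ _ Xx)|x xP] //.
by apply: bX => _ [phi ->] Xphi; exact: xP.
Qed.

Lemma definable0 (L : language) (M : structure L) (V B : Type)
    (sv : V -> lsort L) (sb : B -> lsort L) (b : mtuple M sb)
    (phi : formula sv) : definable b [set x | sat phi x].
Proof.
pose psi : formula (sort_cat sv sb) := frename (rho := inl) phi (fun=> erefl).
exists psi; apply/seteqP.
by split=> y; rewrite /= sat_frename.
Qed.

Lemma type_definable0_closed (L : language) (M : structure L) (V B : Type)
    (sv : V -> lsort L) (sb : B -> lsort L) (b : mtuple M sb)
    (X : set (mtuple M sv)) : type_definable0 X -> type_closed b X.
Proof.
move=> [Gamma ->] x xP phi Gphi.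
by apply: (xP [set x | sat phi x]); [exact: definable0|move=> y /(_ phi Gphi)].
Qed.

(* The coordinates bound by the quantifier are filled with the dummy
   parameters [x0], since they remain variables of the formula. *)
Lemma definable_ex (L : language) (M : structure L) (V W B : Type)
    (sv : V -> lsort L) (sw : W -> lsort L) (sb : B -> lsort L)
    (p : mtuple M sb) (x0 : mtuple M sv) (D : set (mtuple M (sort_cat sv sw))) :
  definable p D -> definable (tcat x0 p) [set y | exists x, D (tcat x y)].
Proof.
move=> [phi ->]; have [l lP] := sat_support M phi.
pose bound (u : (V + W) + B) := if u is inl (inl _) then true else false.
have [psi psiP] := sat_ex M (List.filter bound l) phi.
suff -> : [set y | exists x, [set z | sat phi (tcat z p)] (tcat x y)] =
    (fun y => tcat x0 y) @^-1` [set z | sat psi (tcat z p)].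
  apply: (@definable_preimage _ _ _ _ _ _ _ _ _ _ p); last by exists psi.
  by case=> [[v|w]|b]; [exists (inr (inl v))|exists (inl w)|exists (inr (inr b))];
    exists erefl.
apply/seteqP; split=> y /=.
  move=> [x xy]; apply/psiP.
  exists (fun u => if pselect (List.In u (List.filter bound l))
                   then tcat (tcat x y) p u else tcat (tcat x0 y) p u).
    by move=> u ul; case: pselect.
  apply: (iffLR (lP _ _ _)) xy => u ul; case: pselect => //=.
  by case: u ul => [[v|//]|//] ul; case; apply/List.filter_In.
move=> /psiP[z zP zphi]; exists (tleft (tleft z)).
suff -> : tcat (tcat (tleft (tleft z)) y) p = z by [].
by apply: functional_extensionality_dep => -[[v|w]|b] //=; rewrite zP // =>
  /List.filter_In[].
Qed.

(** * Consequences of compactness and homogeneity for type-definable sets *)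

Section Saturated.
Context (K : Type) (L : language) (M : structure L).
Context (K_lim : strong_limit K) (M_sat : saturated K M).

(** Otherwise the differences of members of [F] with [C] are nonempty and closed under intersection,
    so some point lies in every member of [F] but outside [C]. *)
Lemma compactness_subset (V B : Type) (sv : V -> lsort L) (sb : B -> lsort L)
    (b : mtuple M sb) (F : set (set (mtuple M sv))) (C : set (mtuple M sv)) :
  small K [set: V] -> small K [set: B] -> (forall D, F D -> definable b D) ->
  (forall D E, F D -> F E -> F (D `&` E)) -> F !=set0 -> definable b C ->
  (forall x, (forall D, F D -> D x) -> C x) -> exists2 D, F D & D `<=` C.
Proof.
move=> V_small B_small Fb FI [D0 FD0] bC FC; apply: contrapT => noD.
have [_ [D FD <-]|_ _ [D FD <-] [E FE <-]||_ [D FD <-]|x xP] :=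
  @compactness K L M K_lim M_sat V B sv sb b
    [set D `&` ~` C | D in F] V_small B_small.
- by apply: definableI; [exact: Fb|exact: definableC].
- by exists (D `&` E); [exact: FI|rewrite setIACA setIid].
- by exists (D0 `&` ~` C), D0.
- apply: contrapT => D0'; apply: noD; exists D => // x Dx; apply: contrapT => Cx.
  by apply: D0'; exists x.
have [D0x nCx] : (D0 `&` ~` C) x by apply: xP; exists D0.
by apply: nCx; apply: FC => D FD; have [] : (D `&` ~` C) x by apply: xP; exists D.
Qed.

Lemma compactness_decreasing (V B : Type) (sv : V -> lsort L)
    (sb : B -> lsort L) (b : mtuple M sb) (D : nat -> set (mtuple M sv))
    (C : set (mtuple M sv)) :
  small K [set: V] -> small K [set: B] -> (forall n, definable b (D n)) ->
  (forall m n, (n <= m)%N -> D m `<=` D n) -> definable b C ->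
  (forall x, (forall n, D n x) -> C x) -> exists n, D n `<=` C.
Proof.
move=> V_small B_small bD D_mono bC DC.
have [_ [n _ <-]//|_ _ [m _ <-] [n _ <-]|||x xD|_ [n _ <-]] :=
  compactness_subset (b := b) (F := range D) (C := C) V_small B_small.
- have [mn|/ltnW nm] := leqP m n.
    by exists n => //; apply/esym/setIidPr/D_mono.
  by exists m => //; apply/esym/setIidPl/D_mono.
- by exists (D 0), 0%N.
- exact: bC.
- by apply: DC => n; apply: xD; exists n.
- by exists n.
Qed.

(** A point [y] in every definable superset of the projection has a nonempty fibre in every
    definable superset of [X]; compactness, with [y] among the parameters, gives a point common to
    these fibres. *)
Lemma type_closed_proj (V W B : Type) (sv : V -> lsort L) (sw : W -> lsort L)
    (sb : B -> lsort L) (p : mtuple M sb) (x0 : mtuple M sv)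
    (X : set (mtuple M (sort_cat sv sw))) :
  small K [set: V] -> small K [set: W] -> small K [set: B] ->
  type_closed p X ->
  type_closed (tcat x0 p) [set y | exists x, X (tcat x y)].
Proof.
move=> V_small W_small B_small pX y yP.
have [_ [D [pD XD]] <-|_ _ [D [pD XD] <-] [E [pE XE] <-]||_ [D [pD XD] <-]|x xP] :=
  @compactness K L M K_lim M_sat _ _ sv _ (tcat y p)
    [set (fun x => tcat x y) @^-1` D | D in [set D | definable p D /\ X `<=` D]]
    V_small (small_sum K_lim W_small B_small).
- apply: definable_preimage pD.
  by case=> [[v|w]|b]; [exists (inl v)|exists (inr (inl w))|exists (inr (inr b))];
    exists erefl.
- exists (D `&` E) => //; split; first exact: definableI.
  by move=> z Xz; split; [exact: XD|exact: XE].
- by exists ((fun x => tcat x y) @^-1` setT), setT => //; split=> //; exact: definableT.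
- apply: (yP _ (definable_ex x0 pD)) => z [x Xxz].
  by exists x; exact: XD.
exists x; apply: pX => D pD XD; apply: (xP ((fun x => tcat x y) @^-1` D)).
by exists D.
Qed.

(** If [x] lies in every [a]-definable superset of [X], compactness gives [y] in [X] with the type
    of [x] over [a], and homogeneity moves [y] to [x] by an automorphism fixing [a]. Hence
    invariance allows the parameters [p] to be replaced by [a]. *)
Lemma type_closed_invariant (V B A : Type) (sv : V -> lsort L)
    (sb : B -> lsort L) (sa : A -> lsort L) (p : mtuple M sb) (a : mtuple M sa)
    (X : set (mtuple M sv)) :
  strongly_homogeneous K M ->
  small K [set: V] -> small K [set: B] -> small K [set: A] ->
  type_closed p X ->
  (forall g : automorphism M, act g a = a -> forall x, X x -> X (act g x)) ->
  type_closed a X.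
Proof.
move=> M_hom V_small B_small A_small pX Xinv x xP.
pose F : set (set (mtuple M sv)) := [set C | exists D E,
  [/\ definable p D, X `<=` D, definable a E, E x & C = D `&` E]].
have [_ [D [E [pD _ aE _ ->]]]|_ _ [D [E [pD XD aE Ex ->]]] [D' [E' [pD' XD' aE' Ex' ->]]]
  ||_ [D [E [pD XD aE Ex ->]]]|y yP] :=
  @compactness K L M K_lim M_sat _ _ sv _ (tcat p a) F
    V_small (small_sum K_lim B_small A_small).
- apply: definableI.
    apply: (definable_preimage (f := id)) pD.
    by case=> [v|b]; [exists (inl v)|exists (inr (inl b))]; exists erefl.
  apply: (definable_preimage (f := id)) aE.
  by case=> [v|b]; [exists (inl v)|exists (inr (inr b))]; exists erefl.
- exists (D `&` D'), (E `&` E'); split=> //; [exact: definableI| |exact: definableI|].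
    by move=> z Xz; split; [exact: XD|exact: XD'].
  by rewrite setIACA.
- exists setT; exists setT, setT; split=> //; rewrite ?setIT//; exact: definableT.
- apply: contrapT => DE; suff : (~` E) x by apply.
  apply: xP => [|z Xz Ez]; first exact: definableC.
  by apply: DE; exists z; split=> //; exact: XD.
have Xy : X y.
  apply: pX => D pD XD; suff [] : (D `&` setT) y by [].
  by apply: yP; exists D, setT; split=> //; exact: definableT.
have aE E : definable a E -> E x -> E y.
  move=> aE Ex; suff [] : (setT `&` E) y by [].
  by apply: yP; exists setT, E; split=> //; exact: definableT.
have [|phi|g] := M_hom _ _ (tcat y a) (tcat x a).
- exact: small_sum.
- have pE : definable a [set x | sat phi (tcat x a)] by exists phi.
  split=> [yphi|]; last exact: aE pE.
  by apply: contrapT => /(aE _ (definableC pE)).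
rewrite act_tcat => /tcat_inj[<- ga].
exact: Xinv.
Qed.

End Saturated.

(** * Pseudo-metrics *)

Section PseudoMetrics.
Import Order.TTheory GRing.Theory Num.Theory.
Local Open Scope ring_scope.
Context (R : realType).

Definition pseudo_metric (T : Type) (d : T -> T -> R) : Prop :=
  [/\ forall x y, 0 <= d x y, forall x, d x x = 0, forall x y, d x y = d y x &
      forall x y z, d x z <= d x y + d y z].

Lemma pseudo_metrisableP (T : Type) (closed : set (set T)) :
  pseudo_metrisable R closed <-> exists2 d, pseudo_metric d &
    forall F, closed F <-> forall x, ~ F x ->
      exists2 e : R, 0 < e & forall y, F y -> e <= d x y.
Proof.
have ballP (d : T -> T -> R) (e : R) (F : set T) x :
    [set y | d x y < e] `<=` ~` F <-> forall y, F y -> e <= d x y.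
  split=> h y; first by move=> Fy; rewrite leNgt; apply/negP => /h.
  by move=> /= dy /h; rewrite leNgt dy.
split=> [[d [d0 dxx dC dD dP]]|[d [d0 dxx dC dD] dP]]; exists d.
  by split.
  move=> F; split=> [/dP|] FP; [|apply/dP] => x /FP[e e0 eF]; exists e => //;
    exact/ballP.
split=> // F; split=> [/dP|] FP; [|apply/dP] => x /FP[e e0 eF]; exists e => //;
  exact/ballP.
Qed.

Lemma pseudo_metric_pullback (S T : Type) (f : S -> T) (d : T -> T -> R) :
  pseudo_metric d -> pseudo_metric (fun x y => d (f x) (f y)).
Proof. by move=> [? ? ? ?]; split=> *. Qed.

(** * Suprema of countably many pseudo-metrics *)

Section CountableSup.
Context (T : Type) (r : nat -> T -> T -> R) (rP : forall n, pseudo_metric (r n)).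

Let trunc n x y : R := Num.min n.+1%:R^-1 (r n x y).

Let trunc_ge0 n x y : 0 <= trunc n x y.
Proof. by rewrite le_min invr_ge0 ler0n; case: (rP n) => ->. Qed.

Let trunc_le n x y : trunc n x y <= n.+1%:R^-1.
Proof. by rewrite ge_min lexx. Qed.

Let dsup x y := sup (range (fun n => trunc n x y)).

Let trunc_sup x y : has_sup (range (fun n => trunc n x y)).
Proof.
split; first by exists (trunc 0 x y), 0%N.
exists 1 => _ [n _ <-]; apply: le_trans (trunc_le _ _ _) _.
by rewrite invf_le1 ?ltr0n // ler1n.
Qed.

Let le_dsup n x y : trunc n x y <= dsup x y.
Proof. by apply: (ub_le_sup (trunc_sup x y).2); exists n. Qed.

Let dsup_le x y e : (forall n, trunc n x y <= e) -> dsup x y <= e.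
Proof.
by move=> le_e; apply: ge_sup => [|_ [n _ <-]//]; case: (trunc_sup x y).
Qed.

(** The caps [1/(n+1)] are positive, so each [r n] is controlled by the supremum; they tend to 0, so
    the supremum is controlled by finitely many [r n]. *)
Lemma pseudo_metric_sup : exists2 d, pseudo_metric d &
  (forall n e, 0 < e -> exists2 e', 0 < e' &
     forall x y, d x y < e' -> r n x y < e) /\
  (forall e, 0 < e -> exists N, exists2 e', 0 < e' &
     forall x y, (forall n, (n < N)%N -> r n x y < e') -> d x y < e).
Proof.
exists dsup.
  split=> [x y|x|x y|x y z].
  - exact: le_trans (trunc_ge0 0 x y) (le_dsup _ _ _).
  - apply/eqP; rewrite eq_le (le_trans (trunc_ge0 0 x x)) // andbT.
    apply: dsup_le => n; rewrite /trunc; case: (rP n) => _ -> _ _.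
    by rewrite ge_min lexx orbT.
  - by congr sup; apply/seteqP; split=> _ [n _ <-]; exists n => //;
      rewrite /trunc; case: (rP n) => _ _ ->.
  - apply: dsup_le => n; apply: le_trans (lerD (le_dsup n x y) (le_dsup n y z)).
    have := trunc_ge0 n x y; have := trunc_ge0 n y z.
    rewrite /trunc; have [_ _ _ /(_ x y z)] := rP n.
    move: (n.+1%:R^-1) (r n x z) (r n x y) (r n y z) => q a b c.
    by case: (lerP q a); case: (lerP q b); case: (lerP q c); lra.
split=> [n e e0|e e0].
  exists (Num.min e n.+1%:R^-1) => [|x y]; first by rewrite lt_min e0 invr_gt0 ltr0n.
  move=> /(le_lt_trans (le_dsup n x y)); rewrite /trunc lt_min !gt_min ltxx /=.
  by move=> /andP[/orP[ne|//] nn]; apply: lt_trans ne.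
(* The supremum is bounded only weakly, so half of [e] is aimed at; from index [N] on, the caps
   alone are below it. *)
have e20 : 0 < e / 2 by rewrite divr_gt0.
have [N Ne] : exists N : nat, (e / 2)^-1 < N%:R.
  by exists (Num.Def.archi_bound (e / 2)^-1); apply: archi_boundP; rewrite invr_ge0 ltW.
exists N, (e / 2) => // x y rN.
apply: (@le_lt_trans _ _ (e / 2)); last by rewrite gtr_pMr // invf_lt1 // ltr1n.
apply: dsup_le => n; rewrite /trunc ge_min; have [nN|Nn] := ltnP n N.
  by rewrite (ltW (rN n nN)) orbT.
apply/orP; left; rewrite -[leRHS]invrK lef_pV2 ?posrE ?invr_gt0 ?ltr0n//.
by apply: le_trans (ltW Ne) _; rewrite ler_nat leqW.
Qed.

End CountableSup.

(* Outside the closed set [Q] all points are collapsed to one, at distance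
   [g x] from [x]. *)
Lemma pseudo_metric_collapse (T : Type) (Q : set T) (d : T -> T -> R) (g : T -> R) :
  pseudo_metric d -> (forall x, 0 <= g x) -> (forall x, ~ Q x -> g x = 0) ->
  (forall x y, Q x -> Q y -> g x <= d x y + g y) ->
  exists2 r, pseudo_metric r &
    [/\ forall x y, Q x -> Q y -> r x y = Num.min (d x y) (g x + g y),
        forall x y, ~ (Q x /\ Q y) -> r x y = g x + g y &
        forall x y, r x y <= g x + g y].
Proof.
move=> [d0 dxx dC dD] g0 gQ g_lip.
(* Inside [Q] one goes either directly or through the collapsed point. *)
pose r x y := if pselect (Q x /\ Q y) then Num.min (d x y) (g x + g y)
              else g x + g y.
have rQ x y : Q x -> Q y -> r x y = Num.min (d x y) (g x + g y).
  by move=> Qx Qy; rewrite /r; case: pselect => // -[].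
have rN x y : ~ (Q x /\ Q y) -> r x y = g x + g y.
  by rewrite /r; case: pselect.
have rg x y : r x y <= g x + g y.
  by rewrite /r; case: pselect => //= _; rewrite ge_min lexx orbT.
have rC x y : r x y = r y x.
  rewrite /r; case: pselect => [[Qx Qy]|nQ]; case: pselect => [[Qy' Qx']|nQ'] //=.
  - by rewrite dC addrC.
  - by case: nQ'.
  - by case: nQ.
  - exact: addrC.
have gr x y : g x <= r x y + g y.
  rewrite /r; case: pselect => [[Qx Qy]|nQ] /=; last first.
    by have := g0 y; lra.
  rewrite minEle; case: ifP => _; first exact: g_lip.
  by have := g0 y; lra.
exists r => //; split=> // [x y|x|x y z].
- rewrite /r; case: pselect => _ /=; last exact: addr_ge0.
  by rewrite le_min d0 addr_ge0.
- have [Qx|nQx] := EM (Q x); first by rewrite rQ // dxx min_l // addr_ge0.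
  by rewrite rN ?gQ ?addr0// => -[].
(* If one of the three points is outside [Q], one of the two legs is a sum of values of [g], and
   [gr] bounds the other. *)
have := rg x z; have := gr x y; have := gr z y; rewrite (rC z y).
have [Qx|nQx] := EM (Q x); last by rewrite (rN x y) => [|[]//]; lra.
have [Qz|nQz] := EM (Q z); last by rewrite (rN y z) => [|[]//]; lra.
have [Qy|nQy] := EM (Q y); last by rewrite (rN x y) => [|[]//]; lra.
rewrite !rQ //; have := dD x y z.
move: (d x z) (d x y) (d y z) (g x) (g y) (g z) => a b c p q s.
by case: (lerP a (p + s)); case: (lerP b (p + q)); case: (lerP c (q + s)); lra.
Qed.

Lemma pseudo_metric_dist (T : Type) (d : T -> T -> R) (Z : set T) :
  pseudo_metric d -> exists g : T -> R,
    [/\ forall x, 0 <= g x, forall x y, g x <= d x y + g y,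
        forall x, Z x -> g x = 0 &
        forall x e, 0 < e -> (forall z, Z z -> e <= d x z) -> 0 < g x].
Proof.
move=> [d0 dxx dC dD].
(* The element 1 caps the distance and gives it the value 1 when [Z] is empty. *)
pose S x := [set 1] `|` [set d x z | z in Z].
have S0 x : has_inf (S x).
  split; first by exists 1; left.
  by exists 0 => _ [->|[z _ <-]].
have infP x e : (forall z, Z z -> e <= d x z) -> e <= 1 -> e <= inf (S x).
  by move=> eZ e1; apply: lb_le_inf => [|_ [->|[z Zz <-]]//]; [exists 1; left|exact: eZ].
have g0 x : 0 <= inf (S x) by apply: infP.
have inf_le x t : S x t -> inf (S x) <= t by apply: ge_inf; case: (S0 x).
exists (fun x => inf (S x)); split=> // [x y|x Zx|x e e0 eZ].
- rewrite addrC -lerBlDr; apply: lb_le_inf => [|_ [->|[z Zz <-]]].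
  + by exists 1; left.
  + have := inf_le x 1 (or_introl erefl); have := d0 x y; lra.
  + have := inf_le x _ (or_intror (imageP (d x) Zz)); have := dD x y z; lra.
- by apply/eqP; rewrite eq_le g0 andbT inf_le //; right; exists x.
- apply: (@lt_le_trans _ _ (Num.min e 1)); first by rewrite lt_min e0 ltr01.
  apply: infP; last by rewrite ge_min lexx orbT.
  by move=> z /eZ ez; rewrite ge_min ez.
Qed.

(** * Gluing pseudo-metrics along countably many closed sets whose interiors cover *)

Section Glue.
Context (T : Type) (closed : set (set T)) (Q : nat -> set T)
  (d : nat -> T -> T -> R).
Context (d_pm : forall n, pseudo_metric (d n)).
Context (closedQ : forall n F, F `<=` Q n -> closed F <->
  forall x, Q n x -> ~ F x -> exists2 e, 0 < e & forall y, F y -> e <= d n x y).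
Context (closed_traces : forall F, closed F <-> forall n, closed (F `&` Q n)).
Context (Q_nbhs : forall x, exists n U, [/\ closed (~` U), U x & U `<=` Q n]).

(** The axioms of a topology are not assumed of [closed]; they follow from the metric description of
    the traces on the [Q n]. *)
Let closed_bigcap (C : set (set T)) :
  C `<=` closed -> closed (\bigcap_(F in C) F).
Proof.
move=> Cclosed; apply/closed_traces => n; apply/(closedQ (n := n)) => [|x Qx FQx].
  exact: subIsetr.
have /existsNP[F /not_implyP[CF Fx]] : ~ forall F, C F -> F x.
  by move=> Fx; apply: FQx.
have FQ : F `&` Q n `<=` Q n by exact: subIsetr.
have [|e e0 eF] := (closedQ FQ).1 ((closed_traces F).1 (Cclosed F CF) n) x Qx.
  by case.
by exists e => // y [/(_ F CF) Fy Qy]; apply: eF.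
Qed.

(** The closure of the complement of [Q n]. *)
Let outer n : set T := \bigcap_(F in [set F | closed F /\ ~` Q n `<=` F]) F.

Let closed_outer n : closed (outer n).
Proof. by apply: closed_bigcap => F []. Qed.

Let outerQ n x : ~ outer n x -> Q n x.
Proof. by move=> nO; apply: contrapT => nQ; apply: nO => F [_]; apply. Qed.

Let outer_cover x : exists n, ~ outer n x.
Proof.
have [n [U [U_closed Ux UQ]]] := Q_nbhs x; exists n => /(_ (~` U)); apply=> //.
by split=> // y nQ /UQ.
Qed.

(* The pseudo-metric [r] induces the topology on the interior [~` outer n] of
   [Q n] and is continuous everywhere. *)
Let local_metric n : exists2 r, pseudo_metric r &
  (forall F x, closed F -> ~ F x -> ~ outer n x ->
     exists2 e, 0 < e & forall y, F y -> e <= r x y) /\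
  (forall x e, 0 < e ->
     exists2 F, closed F /\ ~ F x & forall y, ~ F y -> r x y < e).
Proof.
have Zsub : Q n `&` outer n `<=` Q n by exact: subIsetl.
have Zclosed : closed (Q n `&` outer n).
  by rewrite setIC; apply: (iffLR (closed_traces _)); exact: closed_outer.
have [g0 [g0_ge0 g0_lip g0Z g0_gt0]] :=
  pseudo_metric_dist (Q n `&` outer n) (d_pm n).
(* [g0] vanishes on the boundary of [Q n], so the value 0 outside agrees with it there. *)
pose g x := if pselect (Q n x) then g0 x else 0.
have gQ x : Q n x -> g x = g0 x by rewrite /g; case: pselect.
have gN x : ~ Q n x -> g x = 0 by rewrite /g; case: pselect.
have g_ge0 x : 0 <= g x by rewrite /g; case: pselect => _ //=; exact: g0_ge0.
have g_lip x y : Q n x -> Q n y -> g x <= d n x y + g y.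
  by move=> Qx Qy; rewrite !gQ.
have [r r_pm [rQ rN rg]] := pseudo_metric_collapse (d_pm n) g_ge0 gN g_lip.
have gout x : outer n x -> g x = 0.
  by move=> Ox; have [Qx|/gN//] := EM (Q n x); rewrite gQ // g0Z.
exists r; first exact: r_pm.
split=> [F x Fclosed nFx nOx|x e e0].
  have Qx := outerQ nOx.
  have [|e e0 eF] := (closedQ (@subIsetr _ F (Q n))).1
    ((closed_traces F).1 Fclosed n) x Qx; first by case.
  have gx : 0 < g x.
    rewrite gQ //; have [|e' e'0 e'F] := (closedQ Zsub).1 Zclosed x Qx.
      by case.
    exact: g0_gt0 e'0 e'F.
  (* Within [Q n] the direct distance is at least [e]; any passage through the collapsed point costs
     at least [g x]. *)
  exists (Num.min e (g x)) => [|y Fy]; first by rewrite lt_min e0.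
  have [Qy|nQy] := EM (Q n y).
    rewrite rQ // le_min !ge_min eF //=.
    by rewrite lerDl g_ge0 orbT.
  by rewrite rN => [|[]//]; rewrite ge_min lerDl g_ge0 orbT.
have [r0 rxx rC rD] := r_pm.
(* Only the part in [Q n] of the complement of the ball is taken, since there [d n] tests closedness
   and dominates [r]. *)
pose far := Q n `&` [set y | e <= r x y].
have far_closed : closed far.
  apply/(closedQ (n := n)) => [|y Qy]; first exact: subIsetl.
  move=> nfar; have ry : r x y < e.
    by rewrite ltNge; apply/negP => ey; apply: nfar.
  exists (e - r x y) => [|z [Qz /= ez]]; first by rewrite subr_gt0.
  have := rD x y z; have : r y z <= d n y z by rewrite rQ // ge_min lexx.
  lra.
have far_x : ~ far x by move=> [_ /=]; rewrite rxx leNgt e0.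
(* If [x] is in [outer n] then [g x = 0], and all points outside [Q n] are at distance 0. Otherwise
   [outer n] is joined to [far], which keeps the neighbourhood inside [Q n]. *)
have [Ox|nOx] := EM (outer n x).
  exists far => // y nfar; rewrite ltNge; apply/negP => ey.
  have [Qy|nQy] := EM (Q n y); first exact: nfar.
  by move: ey; rewrite rN => [|[]//]; rewrite gout // gN // addr0 leNgt e0.
exists (~` (~` far `&` ~` outer n)) => [|y /contrapT[nfar nOy]].
  split; last by apply.
  rewrite setCI !setCK; apply/closed_traces => m; rewrite setIUl.
  apply/(closedQ (n := m)) => [|y Qy]; first by rewrite -setIUl; exact: subIsetr.
  have cl F : closed F -> ~ (F `&` Q m) y -> exists2 e, 0 < e &
      forall z, (F `&` Q m) z -> e <= d m y z.
    move=> Fclosed; move=> nFy.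
    exact: (closedQ (@subIsetr _ F (Q m))).1 ((closed_traces F).1 Fclosed m) y Qy nFy.
  move=> /not_orP[/(cl _ far_closed)[a a0 aF] /(cl _ (closed_outer n))[b b0 bF]].
  exists (Num.min a b) => [|z [/aF az|/bF bz]]; first by rewrite lt_min a0.
    by rewrite ge_min az.
  by rewrite ge_min bz orbT.
rewrite ltNge; apply/negP => ey; apply: nfar; split=> //; exact: outerQ.
Qed.

(** A closed set is separated from [x] by the one [r n] for which [x] is interior to [Q n].
    Conversely, a ball of the supremum depends on finitely many [r n], all continuous on each [Q m],
    so separation for the supremum gives separation for [d m]. *)
Lemma pseudo_metrisable_glue : pseudo_metrisable R closed.
Proof.
have r_ex n : exists r, pseudo_metric r /\ (
  (forall F x, closed F -> ~ F x -> ~ outer n x ->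
     exists2 e, 0 < e & forall y, F y -> e <= r x y) /\
  (forall x e, 0 < e ->
     exists2 F, closed F /\ ~ F x & forall y, ~ F y -> r x y < e)).
  by have [r rP rP'] := local_metric n; exists r.
have [r rP] := choice r_ex.
have [D D_pm [Dr rD]] := pseudo_metric_sup (fun n => (rP n).1).
apply/pseudo_metrisableP; exists D => // F; split=> [Fclosed x nFx|FP].
  have [n nOx] := outer_cover x.
  have [e e0 eF] := (rP n).2.1 F x Fclosed nFx nOx.
  have [e' e'0 De] := Dr n e e0.
  exists e' => // y Fy; rewrite leNgt; apply/negP => /De.
  by rewrite ltNge eF.
apply/closed_traces => m; apply/(closedQ (n := m)) => [|x Qx nFQ].
  exact: subIsetr.
have [|e e0 eF] := FP x; first by move=> Fx; apply: nFQ.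
have [N [e' e'0 De]] := rD e e0.
have [a a0 aP] : exists2 a, 0 < a & forall y, Q m y -> d m x y < a ->
    forall n, (n < N)%N -> r n x y < e'.
  elim: N {De} => [|N [a a0 IH]]; first by exists 1.
  have [G [Gclosed nGx] Gr] := (rP N).2.2 x e' e'0.
  have [|b b0 bG] := (closedQ (@subIsetr _ G (Q m))).1
    ((closed_traces G).1 Gclosed m) x Qx; first by case.
  exists (Num.min a b) => [|y Qy]; first by rewrite lt_min a0.
  rewrite lt_min => /andP[ya yb] n; rewrite ltnS leq_eqVlt => /orP[/eqP->|].
    by apply: Gr => Gy; move: yb; rewrite ltNge bG.
  exact: IH.
exists a => // y [Fy Qy]; rewrite leNgt; apply/negP => ya.
by have := De x y (aP y Qy ya); rewrite ltNge eF.
Qed.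

End Glue.

(** * Metrisation of a countable base of a uniformity by chains *)

Section Chains.
Context (T : Type) (U : nat -> T -> T -> Prop).
Context (U_refl : forall n x, U n x x) (U_sym : forall n x y, U n x y -> U n y x).
Context (U_trans3 : forall n x y z w,
  U n.+1 x y -> U n.+1 y z -> U n.+1 z w -> U n x w).

Let h (n : nat) : R := (2%:R ^+ n)^-1.
Let weight (s : seq nat) : R := foldr (fun n w => h n + w) 0 s.

Let h_gt0 n : 0 < h n. Proof. by rewrite invr_gt0 exprn_gt0 // ltr0n. Qed.

Let hS n : h n.+1 = h n / 2.
Proof. by rewrite /h exprS invfM mulrC. Qed.

Let weight_ge0 s : 0 <= weight s.
Proof. by elim: s => //= n s IH; rewrite addr_ge0 // ltW. Qed.

Let weight_cat s1 s2 : weight (s1 ++ s2) = weight s1 + weight s2.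
Proof. by elim: s1 => [|n s1 IH] /=; rewrite ?add0r // IH addrA. Qed.

Let Fixpoint chain (s : seq nat) (x z : T) : Prop :=
  if s is n :: s' then exists2 y, U n x y & chain s' y z else x = z.

Let chain_cat s1 s2 x y z :
  chain s1 x y -> chain s2 y z -> chain (s1 ++ s2) x z.
Proof.
by elim: s1 x => [|n s1 IH] x /= => [->//|[x' xx' /IH h12] /h12]; exists x'.
Qed.

Let chain_split s1 s2 x z :
  chain (s1 ++ s2) x z -> exists2 y, chain s1 x y & chain s2 y z.
Proof.
elim: s1 x => [|n s1 IH] x /=; first by exists x.
by move=> [x' xx' /IH[y x'y yz]]; exists y => //; exists x'.
Qed.

(** [m] is the step at which the accumulated weight reaches [c]. *)
Let weight_split s c : s <> [::] -> 0 <= c <= weight s ->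
  exists s1 m s2,
    [/\ s = s1 ++ m :: s2, weight s1 <= c & weight s2 <= weight s - c].
Proof.
elim: s c => // m s IH c _ /= /andP[c0 cs].
have [hm|hm] := leP c (h m).
  by exists [::], m, s; split=> //=; lra.
case: s IH cs => [|k s] IH /= cs; first by exists [::], m, [::]; split=> //=; lra.
have [||s1 [m' [s2 [sE s1c s2c]]]] := IH (c - h m) => //=; first by apply/andP; lra.
exists (m :: s1), m', s2; split=> /=; [by rewrite sE|lra|].
by move: s2c => /=; lra.
Qed.

Let U_mono m n x y : (n <= m)%N -> U m x y -> U n x y.
Proof.
move=> /subnK <-; elim: (m - n)%N => // k IH; rewrite addSn => Uxy.
by apply: IH; apply: U_trans3 Uxy _ _; exact: U_refl.
Qed.

Let h_lt m n : h m < h n -> (n < m)%N.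
Proof.
by rewrite ltf_pV2 ?posrE ?exprn_gt0 ?ltr0n// ltr_eXn2l // ltr1n.
Qed.

(* Cut the chain where its weight is halved: the three parts are
   [U n.+1]-steps. *)
Let chain_lt s n x z : weight s < h n -> chain s x z -> U n x z.
Proof.
elim: {s}_.+1 {-2}s (ltnSn (size s)) n x z => // k IH s sk n x z ws.
have [->/= ->|s0 xz] := eqVneq s [::]; first exact: U_refl.
have [||s1 [m [s2 [sE w1 w2]]]] := @weight_split s (weight s / 2).
- exact/eqP.
- by have := weight_ge0 s; lra.
have := hS n; move: xz; rewrite sE => /chain_split[y xy [y' yy' y'z]] hSn.
have s1k : (size s1 < k)%N.
  by move: sk; rewrite sE size_cat /= addnS !ltnS; apply: leq_trans; exact: leq_addr.
have s2k : (size s2 < k)%N.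
  by move: sk; rewrite sE size_cat /= addnS !ltnS; apply: leq_trans; exact: leq_addl.
apply: (@U_trans3 _ _ y y').
- by apply: IH s1k _ _ _ _ xy; lra.
(* The weight of a single step is less than [h n], so its index exceeds [n]. *)
- apply: U_mono yy'; apply: h_lt; move: ws.
  rewrite sE weight_cat /=; have := weight_ge0 s1; have := weight_ge0 s2; lra.
- by apply: IH s2k _ _ _ _ y'z; lra.
Qed.

(** The infimum of the weights of chains, where a step in [U n] weighs [2^-n]. One-step chains bound
    it above, and [chain_lt] bounds it below. *)
Lemma pseudo_metric_of_entourages : exists2 d, pseudo_metric d &
  (forall e, 0 < e -> exists n, forall x y, U n x y -> d x y < e) /\
  (forall n, exists2 e, 0 < e & forall x y, d x y < e -> U n x y).
Proof.
(* The element 1 serves pairs joined by no chain; as [h n <= 1], an infimum below [h n] always comes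
   from a chain. *)
pose S x y := [set 1] `|` [set weight s | s in [set s | chain s x y]].
have S0 x y : has_inf (S x y).
  by split; [exists 1; left|exists 0 => _ [->//|[s _ <-]]].
have S_le x y t : S x y t -> inf (S x y) <= t by apply: ge_inf; case: (S0 x y).
have Sge0 x y : 0 <= inf (S x y).
  by apply: lb_le_inf => [|_ [->|[s _ <-]]//]; case: (S0 x y).
have Sxx x : inf (S x x) = 0.
  by apply/eqP; rewrite eq_le Sge0 andbT S_le //; right; exists [::].
have SD x y z : inf (S x z) <= inf (S x y) + inf (S y z).
  rewrite -lerBlDr; apply: lb_le_inf; first by case: (S0 x y).
  move=> a xa; rewrite lerBlDr addrC -lerBlDr.
  apply: lb_le_inf; first by case: (S0 y z).
  move=> b yb; rewrite lerBlDr.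
  have a0 : 0 <= a by case: xa => [->|[s _ <-]].
  have b0 : 0 <= b by case: yb => [->|[s _ <-]].
  have S1 := S_le x z 1 (or_introl erefl).
  case: xa a0 => [->|[s xs <-]] a0; first lra.
  case: yb b0 => [->|[s' ys <-]] b0; first lra.
  by rewrite addrC -weight_cat; apply: S_le; right; exists (s ++ s') => //;
    exact: chain_cat ys.
have US n x y : U n x y -> inf (S x y) <= h n.
  move=> Uxy; apply: S_le; right; exists [:: n]; last by rewrite /= addr0.
  by exists y.
have SU n x y : inf (S x y) < h n -> U n x y.
  move=> /inf_lt[|_ [->|[s xy <-]] sn]; first by case: (S0 x y).
    by move: sn; rewrite ltNge invf_le1 ?exprn_gt0 ?ltr0n// exprn_ege1 // ler1n.
  exact: chain_lt xy.
(* Adding both directions gives symmetry without reversing chains, at the cost of the factor 2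
   behind [e / 2] below. *)
exists (fun x y => inf (S x y) + inf (S y x)).
  split=> [x y|x|x y|x y z]; rewrite ?addr_ge0 ?Sxx ?addr0 //.
  - exact: addrC.
  - by have := SD x y z; have := SD z y x; lra.
split=> [e e0|n].
  have [n ne] : exists n, h n < e / 2.
    exists (Num.Def.archi_bound (e / 2)^-1).
    rewrite -[ltRHS]invrK ltf_pV2 ?posrE ?invr_gt0 ?exprn_gt0 ?ltr0n ?divr_gt0//.
    apply: (lt_trans (archi_boundP _)); first by rewrite invr_ge0 ltW ?divr_gt0.
    by rewrite -natrX ltr_nat ltn_expl.
  exists n => x y Uxy; have := US n _ _ Uxy; have := US n _ _ (U_sym Uxy); lra.
exists (h n) => // x y xy; apply: SU; have := Sge0 y x; lra.
Qed.

End Chains.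
End PseudoMetrics.

(** * Hyperdefinable sets *)

Section Automorphisms.
Context (L : language) (M : structure L).

Lemma act_inj (g : automorphism M) (V : Type) (sv : V -> lsort L) :
  injective (@act _ _ g V sv).
Proof.
move=> x y xy; apply: functional_extensionality_dep => v.
apply: (bij_inj (aut_bij g (sv v))).
exact: (congr1 (fun z => z v) xy).
Qed.

Lemma act_surj (g : automorphism M) (V : Type) (sv : V -> lsort L) y :
  exists x, @act _ _ g V sv x = y.
Proof.
have gP v : exists a, aut_map g a = y v.
  by have [f _ fK] := aut_bij g (sv v); exists (f (y v)).
exists (fun v => projT1 (cid (gP v))).
by apply: functional_extensionality_dep => v; rewrite /act; case: cid.
Qed.

Lemma aut_invariantP (K J : Type) (A : J -> hyperimaginary K M) (V : Type)
    (sv : V -> lsort L) (X : set (mtuple M sv)) :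
  aut_invariant A X <->
  forall g : automorphism M, fixes A g -> forall x, X (act g x) <-> X x.
Proof.
split=> [XA g gA x|XA g gA].
  split=> [|Xx]; last by rewrite -(XA g gA); exists x.
  by rewrite -{1}(XA g gA) => -[y Xy /act_inj <-].
apply/seteqP; split=> [_ [x Xx <-]|y Xy]; first exact/XA.
by have [x xy] := act_surj g y; exists x => //; apply/(XA g gA); rewrite xy.
Qed.

Lemma aut_invariant_ex (K J : Type) (A : J -> hyperimaginary K M) (V W : Type)
    (sv : V -> lsort L) (sw : W -> lsort L)
    (X : set (mtuple M (sort_cat sv sw))) :
  aut_invariant A X -> aut_invariant A [set y | exists x, X (tcat x y)].
Proof.
move=> /aut_invariantP XA; apply/aut_invariantP => g gA y.
split=> -[x] /=; last by exists (act g x); rewrite -act_tcat XA.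
by have [x' <-] := act_surj g x; rewrite -act_tcat XA //; exists x'.
Qed.

Lemma aut_invariantI (K J : Type) (A : J -> hyperimaginary K M) (V : Type)
    (sv : V -> lsort L) (X Y : set (mtuple M sv)) :
  aut_invariant A X -> aut_invariant A Y -> aut_invariant A (X `&` Y).
Proof.
move=> /aut_invariantP XA /aut_invariantP YA; apply/aut_invariantP => g gA x.
by rewrite /setI /= XA // YA.
Qed.

Lemma aut_invariant_preimage (K J : Type) (A : J -> hyperimaginary K M)
    (V W : Type) (sv : V -> lsort L) (sw : W -> lsort L)
    (f : mtuple M sw -> mtuple M sv) (X : set (mtuple M sv)) :
  (forall (g : automorphism M) y, f (act g y) = act g (f y)) ->
  aut_invariant A X -> aut_invariant A (f @^-1` X).
Proof.
move=> fP /aut_invariantP XA; apply/aut_invariantP => g gA y.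
by rewrite /preimage /= fP XA.
Qed.

End Automorphisms.

Section Hyperdefinable.
Context (K : Type) (L : language) (M : structure L).
Implicit Types P Q : hyperdefinable K M.

Lemma hclassP P (p : P) : exists2 x, hdom P x & hclass p = hrel P x.
Proof. by case: p => s sP; case: (set_mem sP) => x Xx xs; exists x. Qed.

Lemma hclass_of P x : hdom P x -> exists2 p : P, hclass p x & hclass p = hrel P x.
Proof.
move=> Xx; pose p : P := exist _ (hrel P x) (mem_set (imageP (hrel P) Xx)).
by exists p => //; exact: hrel_refl.
Qed.

Lemma hclass_dom P (p : P) x : hclass p x -> hdom P x.
Proof. by have [y _ ->] := hclassP p => /hrel_dom[]. Qed.

Lemma hclass_nonempty P (p : P) : exists x, hclass p x.
Proof. by have [x Xx ->] := hclassP p; exists x; exact: hrel_refl. Qed.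

Lemma hclass_hrel P (p : P) x y : hclass p x -> hclass p y <-> hrel P x y.
Proof.
have [z Xz ->] := hclassP p => zx; split=> [zy|]; last exact: hrel_trans zx.
exact: hrel_trans (hrel_sym zx) zy.
Qed.

Lemma hclass_inj P (p q : P) x : hclass p x -> hclass q x -> p = q.
Proof.
move=> px qx; apply: val_inj; apply/seteqP.
by split=> y; [move=> /(hclass_hrel _ px)/(hclass_hrel _ qx)|
  move=> /(hclass_hrel _ qx)/(hclass_hrel _ px)].
Qed.

Lemma hpreimE P (W : set P) p x : hclass p x -> hpreim W x <-> W p.
Proof. by move=> px; split=> [[q Wq /(hclass_inj px)->]|]; last exists p. Qed.

Lemma type_definable_preimage (V W : Type) (sv : V -> lsort L)
    (sw : W -> lsort L) (f : mtuple M sw -> mtuple M sv) (X : set (mtuple M sv)) :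
  (forall v, exists w (e : sw w = sv v),
    forall y, f y v = eq_rect _ M (y w) _ e) ->
  type_definable K X -> type_definable K (f @^-1` X).
Proof.
move=> fP /type_definableP[B [sb [b [B_small bX]]]].
apply/type_definableP; exists B, sb, b; split=> //.
apply: type_closed_preimage bX => -[v|c].
  by have [w [e we]] := fP v; exists (inl w), e.
by exists (inr c), erefl.
Qed.

Lemma type_definableI (K_lim : strong_limit K) (V : Type) (sv : V -> lsort L)
    (X Y : set (mtuple M sv)) :
  type_definable K X -> type_definable K Y -> type_definable K (X `&` Y).
Proof.
move=> /type_definableP[B [sb [b [B_small bX]]]].
move=> /type_definableP[C [sc [c [C_small cY]]]].
apply/type_definableP; exists (B + C)%type, (sort_cat sb sc), (tcat b c).
split; first exact: small_sum.
apply: type_closedI.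
  apply: (type_closed_preimage (f := id)) bX.
  by case=> [v|b']; [exists (inl v)|exists (inr (inl b'))]; exists erefl.
apply: (type_closed_preimage (f := id)) cY.
by case=> [v|c']; [exists (inl v)|exists (inr (inr c'))]; exists erefl.
Qed.

Section BwDefinable.
Context (J : Type) (A : J -> hyperimaginary K M).
Context (K_lim : strong_limit K) (M_sat : saturated K M).

(** Saturation keeps projections along a small tuple type-definable, with [x0] as dummy parameters.
    Images and preimages under definable maps are both such projections. *)
Lemma bw_definable_ex (V : Type) (sv : V -> lsort L) P (W : set P)
    (G : set (mtuple M (sort_cat sv (asort P)))) (x0 : mtuple M sv) :
  small K [set: V] -> hpreim W = [set y | exists x, G (tcat x y)] ->
  type_definable K G -> aut_invariant A G -> bw_definable A W.
Proof.
move=> V_small WE /type_definableP[B [sb [b [B_small bG]]]] GA.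
rewrite /bw_definable WE; split; last exact: aut_invariant_ex.
apply/type_definableP; exists (V + B)%type, (sort_cat sv sb), (tcat x0 b).
split; first exact: small_sum.
by apply: (type_closed_proj (K := K)) => //; case: P {W WE} G bG GA.
Qed.

Lemma bw_definable_image (P Q : hyperdefinable K M) (f : P -> Q) (W : set P) :
  bw_definable_map A f -> bw_definable A W -> bw_definable A (f @` W).
Proof.
move=> [fG fA] [WG WA]; have [x0 _] := hdom_nonempty P.
apply: (bw_definable_ex x0 (arity_small P) _ (type_definableI K_lim
  (type_definable_preimage (f := @tleft _ _ _ _ _ _) _ WG) fG)).
- apply/seteqP; split=> [y [_ [p Wp <-] fpy]|y [x [[p Wp px] [q [qx fqy]]]]].
    have [x px] := hclass_nonempty p; exists x; split; first by exists p.
    by exists p.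
  by exists (f q) => //; exists q => //; rewrite -(hclass_inj px qx).
- by move=> v; exists (inl v), erefl.
- apply: aut_invariantI fA; apply: aut_invariant_preimage WA.
  by [].
Qed.

(** The graph is flipped because [bw_definable_ex] projects away the left block. *)
Lemma bw_definable_preimage (P Q : hyperdefinable K M) (f : P -> Q) (W : set Q) :
  bw_definable_map A f -> bw_definable A W -> bw_definable A (f @^-1` W).
Proof.
move=> [fG fA] [WG WA]; have [y0 _] := hdom_nonempty Q.
pose swap (z : mtuple M (sort_cat (asort Q) (asort P))) := tcat (tright z) (tleft z).
apply: (bw_definable_ex y0 (arity_small Q) _ (type_definableI K_lim
  (type_definable_preimage (f := @tleft _ _ _ _ _ _) _ WG)
  (type_definable_preimage (f := swap) _ fG))).
- apply/seteqP; split=> [x [p Wfp px]|x [y [[q Wq qy] [p [px fpy]]]]].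
    have [y fpy] := hclass_nonempty (f p); exists y; split; first by exists (f p).
    by exists p.
  by exists p => //=; rewrite (hclass_inj fpy qy).
- by move=> v; exists (inl v), erefl.
- by case=> v; [exists (inr v)|exists (inl v)]; exists erefl.
- apply: aut_invariantI; first by apply: aut_invariant_preimage WA.
  by apply: aut_invariant_preimage fA => g z; rewrite act_tcat.
Qed.

End BwDefinable.
End Hyperdefinable.

(** * Piecewise hyperdefinable sets *)

Section Limit.
Context (K : Type) (L : language) (M : structure L).
Context (J : Type) (A : J -> hyperimaginary K M).
Context (P : piecewise_hyperdefinable A).

Local Notation into i := (@Defs.lim_in K L M J A P i).

Lemma transition_irr i j (h h' : ile i j) (x : piece P i) :
  transition h x = transition h' x.
Proof. by rewrite (Prop_irrelevance h h'). Qed.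

Lemma lim_eq_refl (u : {i : pw_index P & piece P i}) : lim_eq u u.
Proof. by exists (projT1 u), (ile_refl _), (ile_refl _). Qed.

Lemma lim_eq_sym (u v : {i : pw_index P & piece P i}) : lim_eq u v -> lim_eq v u.
Proof. by move=> [k [hu [hv uv]]]; exists k, hv, hu. Qed.

Lemma lim_eq_trans (u v w : {i : pw_index P & piece P i}) :
  lim_eq u v -> lim_eq v w -> lim_eq u w.
Proof.
move=> [k [hu [hv uv]]] [l [hv' [hw vw]]].
have [m [km lm]] := ile_directed k l.
exists m, (ile_trans hu km), (ile_trans hw lm).
rewrite -(transition_comp hu km) uv -(transition_comp hw lm) -vw.
by rewrite !(transition_comp _ _ (ile_trans hv km)).
Qed.

Lemma into_eqP i j (x : piece P i) (y : piece P j) :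
  into _ x = into _ y <-> lim_eq (existT _ i x) (existT _ j y).
Proof.
split=> [/(congr1 val)/= ->|xy]; first exact: lim_eq_refl.
apply: val_inj; apply/seteqP; split=> w /=; last exact: lim_eq_trans.
exact/lim_eq_trans/lim_eq_sym.
Qed.

Lemma into_inj i : injective (into i).
Proof.
move=> x y /into_eqP[k [hx [hy]]] /=.
by rewrite (transition_irr hy hx) => /transition_inj.
Qed.

Lemma into_transition i j (h : ile i j) (x : piece P i) :
  into _ (transition h x) = into _ x.
Proof.
apply/into_eqP; exists j, (ile_refl j), h => /=; exact: transition_id.
Qed.

Context (K_lim : strong_limit K) (M_sat : saturated K M).

(** In a common upper piece [k], the trace on piece [j] is the preimage under one transition map of
    the image under another. *)
Lemma into_closed i (F : set (piece P i)) :
  bw_definable A F -> logic_closed P (into i @` F).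
Proof.
move=> AF j; have [k [ik jk]] := ile_directed i j.
suff -> : into j @^-1` (into i @` F) =
    transition jk @^-1` (transition ik @` F).
  apply: bw_definable_preimage (transition_definable jk) _ => //.
  exact: bw_definable_image (transition_definable ik) AF.
apply/seteqP; split=> y [x Fx xy]; exists x => //.
  by apply: (@into_inj k); rewrite !into_transition.
by rewrite -(into_transition ik) xy into_transition.
Qed.

Lemma into_closedP i (F : set (piece P i)) :
  logic_closed P (into i @` F) <-> bw_definable A F.
Proof.
split=> [/(_ i)|]; last exact: into_closed.
suff -> : into i @^-1` (into i @` F) = F by [].
by apply/seteqP; split=> [y [x Fx /into_inj<-]|y Fy] //; exists y.
Qed.

Lemma logic_closed_cofinal (C : set (pw_index P)) (W : set (limit P)) :
  (forall i, exists2 j, C j & ile i j) ->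
  (forall j, C j -> bw_definable A (into j @^-1` W)) ->
  logic_closed P W.
Proof.
move=> Ccof CW i; have [j Cj ij] := Ccof i.
suff -> : into i @^-1` W =
    transition ij @^-1` (into j @^-1` W).
  exact: bw_definable_preimage (transition_definable ij) (CW j Cj).
by apply/seteqP; split=> x; rewrite /preimage /= into_transition.
Qed.

Lemma pseudo_metrisable_piece (R : realType) i :
  pseudo_metrisable R (logic_closed P) ->
  pseudo_metrisable R (piece_logic_closed A (piece P i)).
Proof.
move=> /pseudo_metrisableP[d d_pm dP]; apply/pseudo_metrisableP.
exists (fun x y => d (into _ x) (into _ y)); first exact: pseudo_metric_pullback.
move=> F; split=> [/into_closedP/dP FP x nFx|FP].
  have [|e e0 eF] := FP (into _ x); first by move=> [y Fy /into_inj yx]; rewrite yx in Fy.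
  by exists e => // y Fy; apply: eF; exists y.
(* The [d]-closure of [F] in the limit: it is closed for the logic topology, and its trace on the
   piece is [F]. *)
pose cl : set (limit P) := [set t | forall e : R, (0 < e)%R ->
  exists2 y, F y & (d t (into _ y) < e)%R].
suff clP : logic_closed P cl.
  have := clP i; suff -> : into i @^-1` cl = F by [].
  apply/seteqP; split=> [x xcl|x Fx e e0]; last first.
    by exists x => //; case: d_pm => _ -> _ _.
  apply: contrapT => /FP[e e0 eF]; have [y Fy] := xcl e e0.
  by rewrite Order.TotalTheory.ltNge eF.
apply/dP => t /existsNP[e /not_implyP[e0 eF]].
have e20 : (0 < e / 2)%R by lra.
exists (e / 2)%R => //.
move=> s scl; rewrite Order.TotalTheory.leNgt; apply/negP => ts.
have [y Fy sy] := scl _ e20.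
apply: eF; exists y => //; have [_ _ _ /(_ t s (into _ y))] := d_pm.
by move: ts sy; lra.
Qed.

Lemma pseudo_metrisable_limit (R : realType) :
  locally_hyperdefinable P -> countable_cofinality P ->
  (forall i, pseudo_metrisable R (piece_logic_closed A (piece P i))) ->
  pseudo_metrisable R (logic_closed P).
Proof.
move=> P_local [C [C_count Ccof]] P_met.
have [i0] := pw_inhabited P; have [c0 Cc0 _] := Ccof i0.
(* [C] is enumerated along an injection to [nat]; numbers outside its range get the default [c0]. *)
have [c [cC Ccof']] : exists c : nat -> pw_index P, (forall n, C (c n)) /\
    forall i, exists n, ile i (c n).
  have /countable_injP[f f_inj] := C_count.
  pose c n := if pselect (exists2 j, C j & f j = n) is left e
              then projT1 (cid2 e) else c0.
  exists c; split=> [n|i]; first by rewrite /c; case: pselect => // e; case: cid2.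
  have [j Cj ij] := Ccof i; exists (f j); rewrite /c.
  case: pselect => [e|]; last by case; exists j.
  case: cid2 => k /= Ck fk; suff -> : k = j by [].
  by apply: f_inj; rewrite ?inE.
have d_ex n : exists d : piece P (c n) -> piece P (c n) -> R,
    pseudo_metric d /\ forall F, bw_definable A F <-> forall x, ~ F x ->
      exists2 e : R, (0 < e)%R & forall y, F y -> (e <= d x y)%R.
  by have /pseudo_metrisableP[d] := P_met (c n); exists d.
pose d n := projT1 (cid (d_ex n)).
have d_pm n : pseudo_metric (d n) by rewrite /d; case: cid => ? [].
have dP n F : bw_definable A F <-> forall x, ~ F x ->
    exists2 e : R, (0 < e)%R & forall y, F y -> (e <= d n x y)%R.
  by rewrite /d; case: cid => ? [].
(* The gluing wants pseudo-metrics on the whole limit, so [d n] is pulled back along a left inverse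
   of [into]. Its values off the piece are arbitrary and never tested. *)
have retract_ex n : exists r : limit P -> piece P (c n), cancel (into (c n)) r.
  have [x /hclass_of[p _ _]] := hdom_nonempty (piece P (c n)).
  exists (fun t => if pselect (exists y, into (c n) y = t) is left e
                   then projT1 (cid e) else p) => y.
  case: pselect => [e|]; last by case; exists y.
  by case: cid => z /= /into_inj.
pose r n := projT1 (cid (retract_ex n)).
have rK n : cancel (into (c n)) (r n) by rewrite /r; case: cid.
have traceE n (F : set (limit P)) : F `&` range (into (c n)) =
    into (c n) @` (into (c n) @^-1` F).
  apply/seteqP; split=> [t [Ft [x _ xt]]|_ [x Fx <-]].
    by exists x => //; rewrite /preimage /= xt.
  by split=> //; exists x.
apply: (pseudo_metrisable_glue (Q := fun n => range (into (c n)))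
  (d := fun n t u => d n (r n t) (r n u))).
- by move=> n; exact: pseudo_metric_pullback.
- move=> n F FQ.
  have FE : F = into (c n) @` (into (c n) @^-1` F) by rewrite -traceE setIidl.
  rewrite {1}FE into_closedP dP; split=> [FP _ [x _ <-] nFx|FP x nFx].
    have [e e0 eF] := FP x nFx; exists e => // y Fy.
    by have [z _ zy] := FQ y Fy; rewrite -zy !rK; apply: eF; rewrite /preimage /= zy.
  have [|e e0 eF] := FP (into (c n) x) _ nFx; first by exists x.
  by exists e => // y /eF; rewrite !rK.
- move=> F; split=> [FP n|FP].
    by rewrite traceE into_closedP; exact: FP.
  apply: (logic_closed_cofinal (C := range c)) => [i|_ [n _ <-]].
    by have [n ?] := Ccof' i; exists (c n).
  by rewrite -into_closedP -traceE.
- move=> t; have [N [[_ [i NP]] [U [Uc Ut UN]]]] := P_local t.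
  have [n icn] := Ccof' i; exists n, U; split=> // u /UN/NP[x _ <-].
  by exists (transition icn x) => //; exact: into_transition.
Qed.

End Limit.

(** * Countable languages *)

Section Countability.
Context (L : language).
Context (cs : lsort L -> nat) (cf : lfun L -> nat) (cr : lrel L -> nat).
Context (cs_inj : injective cs) (cf_inj : injective cf) (cr_inj : injective cr).

(** The sort is not recorded, as the head symbol or variable determines it; hence injectivity is
    stated across sorts with [existT]. *)
Fixpoint term_code (V : Type) (sv : V -> lsort L) (cv : V -> nat) s
    (t : term sv s) : GenTree.tree nat :=
  match t with
  | Var v => GenTree.Leaf (cv v)
  | App f args => GenTree.Node (cf f)
      [seq term_code cv (args i) | i <- enum 'I_(fun_arity f)]
  end.

(** As with de Bruijn indices, a bound variable gets code 0 and the others are shifted, so the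
    coding of variables stays injective. *)
Fixpoint formula_code (V : Type) (sv : V -> lsort L) (cv : V -> nat)
    (phi : formula sv) : GenTree.tree nat :=
  match phi with
  | FEq _ t u => GenTree.Node 0 [:: term_code cv t; term_code cv u]
  | FRel r args => GenTree.Node 1
      (GenTree.Leaf (cr r) :: [seq term_code cv (args i) | i <- enum 'I_(rel_arity r)])
  | FBot => GenTree.Node 2 [::]
  | FImp phi psi => GenTree.Node 3 [:: formula_code cv phi; formula_code cv psi]
  | FAll s psi => GenTree.Node 4 [:: GenTree.Leaf (cs s);
      formula_code (fun o => if o is Some v then (cv v).+1 else 0%N) psi]
  end.

Lemma term_code_inj (V : Type) (sv : V -> lsort L) (cv : V -> nat) s s'
    (t : term sv s) (t' : term sv s') : injective cv ->
  term_code cv t = term_code cv t' -> existT (term sv) s t = existT (term sv) s' t'.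
Proof.
move=> cv_inj; elim: t s' t' => [v|f args IH] s' [v'|f' args'] //= [].
  by move=> /cv_inj <-.
move=> /cf_inj ff'; subst f' => /eq_in_map args_eq.
suff -> : args = args' by [].
apply: functional_extensionality_dep => i.
by apply/existT_inj/IH/args_eq; rewrite mem_enum.
Qed.

Lemma formula_code_inj (V : Type) (sv : V -> lsort L) (cv : V -> nat) :
  injective cv -> injective (@formula_code V sv cv).
Proof.
move=> cv_inj phi; elim: phi cv cv_inj => {V sv}
  [V sv s t u|V sv r args|V sv|V sv phi IH1 psi IH2|V sv s psi IH] cv cv_inj
  [s' t' u'|r' args'||phi' psi'|s' psi'] //= [].
- move=> /(term_code_inj cv_inj) tt' /(term_code_inj cv_inj) uu'.
  have ss' := congr1 (@projT1 _ _) tt'; move: ss' => /= ss'; subst s'.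
  by rewrite (existT_inj tt') (existT_inj uu').
- move=> /cr_inj rr'; subst r' => /eq_in_map args_eq.
  suff -> : args = args' by [].
  apply: functional_extensionality_dep => i.
  by apply/existT_inj/(term_code_inj cv_inj)/args_eq; rewrite mem_enum.
- by move=> /(IH1 _ cv_inj) -> /(IH2 _ cv_inj) ->.
- by move=> /cs_inj ss'; subst s' => /IH -> // -[x|] [y|] // [] /cv_inj ->.
Qed.

End Countability.

Lemma countable_sum_split (S T : Type) :
  countable [set: (S + T)%type] -> countable [set: S] /\ countable [set: T].
Proof.
move=> /card_leTTP[f f_inj]; split; apply/card_leTTP.
  by exists (f \o inl) => x y /f_inj[].
by exists (f \o inr) => x y /f_inj[].
Qed.

Lemma countable_sum (S T : Type) :
  countable [set: S] -> countable [set: T] -> countable [set: (S + T)%type].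
Proof.
move=> /card_leTTP[f f_inj] /card_leTTP[g g_inj]; apply/card_leTTP.
exists (fun u => match u with inl x => (f x).*2 | inr y => (g y).*2.+1 end).
move=> [x|x] [y|y] => [/double_inj/f_inj->|xy|xy|[/double_inj/g_inj->]] //.
  by have := congr1 odd xy; rewrite /= !odd_double.
by have := congr1 odd xy; rewrite /= !odd_double.
Qed.

Lemma countable_definable (L : language) (M : structure L) (V B : Type)
    (sv : V -> lsort L) (sb : B -> lsort L) (b : mtuple M sb) :
  language_countable L -> countable [set: V] -> countable [set: B] ->
  exists D : nat -> set (mtuple M sv), forall E, definable b E <-> range D E.
Proof.
move=> /countable_sum_split[/countable_sum_split[]].
move=> /card_leTTP[cs cs_inj] /card_leTTP[cf cf_inj] /card_leTTP[cr cr_inj].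
move=> V_count B_count; have /card_leTTP[cv cv_inj] := countable_sum V_count B_count.
pose code (phi : formula (sort_cat sv sb)) := pickle (formula_code cs cf cr cv phi).
have code_inj : injective code.
  apply: inj_comp (formula_code_inj cs_inj cf_inj cr_inj cv_inj).
  exact: pcan_inj pickleK.
(* Numbers that code no formula yield [setT], which is itself definable. *)
exists (fun n => if pselect (exists phi, code phi = n) is left e
                 then [set x | sat (projT1 (cid e)) (tcat x b)] else setT) => E.
split=> [[phi ->]|[n _ <-]].
  exists (code phi) => //; case: pselect => [e|]; last by case; exists phi.
  by case: cid => psi /= /code_inj ->.
by case: pselect => [e|_]; [exists (projT1 (cid e))|exact: definableT].
Qed.

Section AutomorphismGroup.
Context (L : language) (M : structure L).

Lemma eval_act (g : automorphism M) (V : Type) (sv : V -> lsort L) s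
    (t : term sv s) (x : mtuple M sv) : eval (act g x) t = g s (eval x t).
Proof.
elim: t => [v|f args IH] //=; rewrite aut_fun; congr fun_interp.
exact: functional_extensionality_dep.
Qed.

Lemma sat_act (g : automorphism M) (V : Type) (sv : V -> lsort L)
    (phi : formula sv) (x : mtuple M sv) : sat phi (act g x) <-> sat phi x.
Proof.
elim: phi x => {V sv}
  [V sv s t u|V sv r args|V sv|V sv phi IH1 psi IH2|V sv s psi IH] x //=.
- by rewrite !eval_act; split=> [/(bij_inj (aut_bij g s))|->].
- suff -> : (fun i => eval (act g x) (args i)) =
            (fun i => g _ (eval x (args i))) by rewrite -aut_rel.
  by apply: functional_extensionality_dep => i; rewrite eval_act.
- by rewrite IH1 IH2.
- have actE a : act g (tcons a x) = tcons (g s a) (act g x).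
    by apply: functional_extensionality_dep; case.
  split=> psiA a; first by have := psiA (g s a); rewrite -actE IH.
  have [f _ fK] := aut_bij g s; rewrite -(fK a) -actE IH; exact: psiA.
Qed.

Lemma type_definable0_act (g : automorphism M) (V : Type) (sv : V -> lsort L)
    (X : set (mtuple M sv)) x : type_definable0 X -> X (act g x) <-> X x.
Proof.
by move=> [Gamma ->]; split=> xG phi /xG; rewrite sat_act.
Qed.

Definition aut_id : automorphism M.
Proof.
by exists (fun s a => a) => // s; exists id.
Defined.

Definition aut_comp (g h : automorphism M) : automorphism M.
Proof.
exists (fun s a => g s (h s a)) => [s|f a|r a].
- exact: bij_comp (aut_bij g s) (aut_bij h s).
- by rewrite !aut_fun.
- by rewrite (aut_rel h) (aut_rel g).
Defined.

Lemma aut_inv (g : automorphism M) : exists h : automorphism M,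
  forall (V : Type) (sv : V -> lsort L) (x : mtuple M sv),
    act h (act g x) = x /\ act g (act h x) = x.
Proof.
have inv_ex s : exists f, cancel (g s) f /\ cancel f (g s).
  by have [f] := aut_bij g s; exists f.
pose f s := projT1 (cid (inv_ex s)).
have gK s : cancel (g s) (f s) by rewrite /f; case: cid => ? [].
have fK s : cancel (f s) (g s) by rewrite /f; case: cid => ? [].
unshelve eexists (@Automorphism L M f _ _ _).
- by move=> s; exists (g s).
- move=> k a; apply: (can_inj (gK _)); rewrite fK aut_fun; congr fun_interp.
  by apply: functional_extensionality_dep => i; rewrite fK.
- move=> r a; rewrite (aut_rel g (fun i => f _ (a i))).
  suff -> : (fun i => g _ (f _ (a i))) = a by [].
  by apply: functional_extensionality_dep => i; rewrite fK.
by move=> V sv x; split; apply: functional_extensionality_dep => v;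
  rewrite /act /= ?gK ?fK.
Qed.

End AutomorphismGroup.

(** * Metrisation of a countable piece *)

Section CountablePiece.
Context (K : Type) (L : language) (M : structure L).
Context (K_lim : strong_limit K) (K_nat : small K [set: nat])
  (M_sat : saturated K M) (M_hom : strongly_homogeneous K M).
Context (L_count : language_countable L).
Context (J : Type) (A : J -> hyperimaginary K M) (J_count : countable [set: J])
  (A_count : forall j, countable [set: arity (hi_set (A j))]).
Context (Q : hyperdefinable K M) (Q_over : hyperdefinable_over A Q)
  (Q_count : countable [set: arity Q]).

Let sv : arity Q -> lsort L := @asort K L M Q.

Let aidx : Type := {j : J & arity (hi_set (A j))}.
Let sa (u : aidx) : lsort L := asort (hi_set (A (projT1 u))) (projT2 u).
Let block (j : J) (b : mtuple M sa) : mtuple M (asort (hi_set (A j))) :=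
  fun v => b (existT _ j v).
(* A real tuple representing [A]. *)
Let a : mtuple M sa := fun u =>
  projT1 (cid (hclass_nonempty (hi_point (A (projT1 u))))) (projT2 u).

Let hclass_block j : hclass (hi_point (A j)) (@block j a).
Proof. exact: (projT2 (cid (hclass_nonempty (hi_point (A j))))). Qed.

Let aidx_count : countable [set: aidx].
Proof.
have /card_leTTP[f f_inj] := J_count.
have g_ex j : exists g : arity (hi_set (A j)) -> nat, injective g.
  by have /card_leTTP := A_count j.
pose g j := projT1 (cid (g_ex j)).
have g_inj j : injective (g j) by rewrite /g; case: cid.
apply/card_leTTP; exists (fun u => pickle (f (projT1 u), g _ (projT2 u))).
move=> [i x] [j y] /(pcan_inj pickleK)/= [/f_inj ij]; subst j.
by move=> /g_inj ->.
Qed.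

Let a_small : small K [set: aidx].
Proof. exact: small_countable aidx_count. Qed.

Let Q_small : small K [set: arity Q]. Proof. exact: arity_small. Qed.

(** [b] is another real tuple representing the same hyperimaginaries. *)
Let a_equiv (b : mtuple M sa) : Prop :=
  forall j, hrel (hi_set (A j)) (@block j a) (@block j b).

Let hrel0_act (j : J) (g : automorphism M) x y :
  hrel (hi_set (A j)) (act g x) (act g y) <-> hrel (hi_set (A j)) x y.
Proof.
have := type_definable0_act g (tcat x y) (hi_hrel0 (A j)).
by rewrite act_tcat.
Qed.

(** Automorphisms permute the classes of a relation type-definable without parameters, so fixing a
    class can be tested on one representative. *)
Let fixesP (g : automorphism M) : fixes A g <-> a_equiv (act g a).
Proof.
have cl j y : hclass (hi_point (A j)) y <-> hrel (hi_set (A j)) (@block j a) y.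
  exact: hclass_hrel.
split=> [gA j|ga j].
  by apply/cl; rewrite -(gA j); exists (@block j a).
apply/seteqP; split=> [_ [y /cl ay <-]|y /cl ay].
  apply/cl; apply: hrel_trans (ga j) _.
  by rewrite (hrel0_act g (@block j a) y).
have [x xy] := act_surj g y; exists x => //; apply/cl.
rewrite -(hrel0_act g) xy; apply: hrel_trans ay.
exact: hrel_sym (ga j).
Qed.

Let fixes_id : fixes A (aut_id M).
Proof. by apply/fixesP => j; apply/hclass_hrel. Qed.

Let fixes_comp (g h : automorphism M) :
  fixes A g -> fixes A h -> fixes A (aut_comp g h).
Proof.
move=> /fixesP gA /fixesP hA; apply/fixesP => j.
apply: hrel_trans (gA j) _.
exact/(hrel0_act g (@block j a) (@block j (act h a)))/hA.
Qed.

Let fixes_inv (g h : automorphism M) : act g (act h a) = a ->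
  fixes A g -> fixes A h.
Proof.
move=> gh /fixesP gA; apply/fixesP => j.
rewrite -(hrel0_act g); apply: hrel_trans (hrel_sym (gA j)) _.
rewrite -[act g (@block j (act h a))]/(@block j (act g (act h a))) gh.
exact/hclass_hrel.
Qed.

Let hdom_act g x : fixes A g -> hdom Q (act g x) <-> hdom Q x.
Proof. by move=> gA; have [/aut_invariantP->] := Q_over. Qed.

Let hrel_act g x y : fixes A g -> hrel Q (act g x) (act g y) <-> hrel Q x y.
Proof.
move=> gA; have [_ /aut_invariantP/(_ g gA (tcat x y))] := Q_over.
by rewrite act_tcat.
Qed.

Let orbit (x y : mtuple M sv) : Prop :=
  exists2 g : automorphism M, fixes A g & hrel Q (act g x) y.

Let orbit_refl x : hdom Q x -> orbit x x.
Proof. by move=> Xx; exists (aut_id M) => //; exact: hrel_refl. Qed.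

Let orbit_sym x y : orbit x y -> orbit y x.
Proof.
move=> [g gA gxy]; have [h hP] := aut_inv g; exists h.
  by apply: fixes_inv gA; have [] := hP _ _ a.
have hA : fixes A h by apply: fixes_inv gA; have [] := hP _ _ a.
by apply: hrel_sym; have := gxy; rewrite -(hrel_act _ _ hA) (hP _ _ x).1.
Qed.

Let orbit_trans x y z : orbit x y -> orbit y z -> orbit x z.
Proof.
move=> [g gA gxy] [h hA hyz]; exists (aut_comp h g); first exact: fixes_comp.
by apply: hrel_trans hyz; apply/(hrel_act _ _ hA).
Qed.

Let orbit_hdom x y : orbit x y -> hdom Q x /\ hdom Q y.
Proof.
by move=> [g gA /hrel_dom[gx Xy]]; split=> //; apply/(hdom_act _ gA).
Qed.

Let orbit_graph : set (mtuple M (sort_cat sv sv)) :=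
  [set z | orbit (tleft z) (tright z)].

(** By homogeneity the images of the tuple [(x, a)] under automorphisms are the tuples of the same
    type. The automorphism is thus replaced by the tuple [(w, b)], over which one can project. *)
Let orbitP x y : orbit x y <-> exists w b,
  [/\ hrel Q w y, a_equiv b &
      forall phi : formula (sort_cat sv sa), sat phi (tcat x a) <-> sat phi (tcat w b)].
Proof.
split=> [[g gA gxy]|[w [b [wy ab xw]]]].
  exists (act g x), (act g a); split=> // [|phi]; first exact/fixesP.
  by rewrite -act_tcat sat_act.
have [g] := M_hom (small_sum K_lim Q_small a_small) xw.
rewrite act_tcat => /tcat_inj[gx ga]; exists g; last by rewrite gx.
by apply/fixesP; rewrite ga.
Qed.

(** [orbitP] exhibits the graph as a projection of a type-definable set; invariance under
    automorphisms fixing [a] then removes the parameters [b] and the dummies. *)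
Let orbit_graph_closed : type_closed a orbit_graph.
Proof.
have [x0 _] := hdom_nonempty Q.
have /type_definableP[B [sb [b [B_small bE]]]] := hrel_type_definable Q.
pose W := sort_cat (sort_cat sv sa) (sort_cat sv sv).
pose p := tcat b a.
(* [S1], [S2], [S3] are the three conditions of [orbitP], the variables being grouped as
   [((w, c), (x, y))]. *)
pose S1 : set (mtuple M W) := (fun u => tcat (tleft (tleft u)) (tright (tright u)))
  @^-1` graph_of (hrel Q).
pose S2 : set (mtuple M W) := \bigcap_(j in setT)
  (fun u => tcat (@block j a) (@block j (tright (tleft u))))
  @^-1` graph_of (hrel (hi_set (A j))).
pose S3 : set (mtuple M W) := \bigcap_(phi in [set: formula (sort_cat sv sa)])
  [set u | sat phi (tcat (tleft (tright u)) a) <-> sat phi (tleft u)].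
have S1p : type_closed p S1.
  apply: type_closed_preimage bE => -[[v|v]|c].
  - by exists (inl (inl (inl v))), erefl.
  - by exists (inl (inr (inr v))), erefl.
  - by exists (inr (inl c)), erefl.
have S2p : type_closed p S2.
  apply: type_closed_bigcap => j _.
  apply: (type_closed_preimage (p := a)
    (f := fun u : mtuple M W => tcat (@block j a) (@block j (tright (tleft u))))
    (X := graph_of (hrel (hi_set (A j))))); last first.
    exact: type_definable0_closed (hi_hrel0 (A j)).
  move=> [[v|v]|c].
  - by exists (inr (inr (existT _ j v))), erefl.
  - by exists (inl (inl (inr (existT _ j v)))), erefl.
  - by exists (inr (inr c)), erefl.
have S3p : type_closed p S3.
  apply: type_closed_bigcap => phi _; apply: definable_type_closed.
  have D1 : definable p [set u : mtuple M W | sat phi (tcat (tleft (tright u)) a)].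
    apply: (definable_preimage (p := a) (f := fun u : mtuple M W => tleft (tright u))
      (D := [set x | sat phi (tcat x a)])); last by exists phi.
    by case=> [v|c]; [exists (inl (inr (inl v)))|exists (inr (inr c))]; exists erefl.
  have D2 : definable p [set u : mtuple M W | sat phi (tleft u)].
    apply: (definable_preimage (p := a) (f := fun u : mtuple M W => tleft u)
      (D := [set x | sat phi x])); last exact: definable0.
    by case=> [v|c]; [exists (inl (inl v))|exists (inr (inr c))]; exists erefl.
  rewrite (_ : [set u | _] = [set u | [set u : mtuple M W |
      sat phi (tcat (tleft (tright u)) a)] u -> [set u | sat phi (tleft u)] u] `&`
    [set u | [set u : mtuple M W | sat phi (tleft u)] u ->
      [set u | sat phi (tcat (tleft (tright u)) a)] u]).
    by apply: definableI; exact: definable_imply.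
  by apply/seteqP; split=> u.
have orbitE : orbit_graph = [set z | exists wb : mtuple M (sort_cat sv sa),
    (S1 `&` (S2 `&` S3)) (tcat wb z)].
  apply/seteqP; split=> [z /orbitP[w [c [wy ac xw]]]|z [wb [wy [ac xw]]]].
    by exists (tcat w c); split=> //; split=> [j _|phi _]; [exact: ac|exact: xw].
  apply/orbitP; exists (tleft wb), (tright wb); split=> // [j|phi].
    exact: ac.
  by rewrite tcatE; exact: xw.
have va_small := small_sum K_lim Q_small a_small.
have vv_small := small_sum K_lim Q_small Q_small.
have p_small := small_sum K_lim B_small a_small.
apply: (type_closed_invariant (p := tcat (tcat x0 a) p) K_lim M_sat M_hom
  vv_small _ a_small).
- exact: small_sum.
- rewrite orbitE; apply: (type_closed_proj _ M_sat) => //.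
  by do !apply: type_closedI.
- move=> g ga z [h hA hz].
  have gA : fixes A g by apply/fixesP => j; rewrite ga; apply/hclass_hrel.
  have [k kP] := aut_inv g.
  have kA : fixes A k by apply: fixes_inv gA; have [] := kP _ _ a.
  (* The conjugate of [h] by [g], where [k] is the inverse of [g]. *)
  exists (aut_comp (aut_comp g h) k); first by do 2 apply: fixes_comp => //.
  have -> : act (aut_comp (aut_comp g h) k) (tleft (act g z)) =
      act g (act h (act k (act g (tleft z)))) by [].
  by rewrite (kP _ _ (tleft z)).1; apply/(hrel_act _ _ gA).
Qed.

Let hdom_closed : type_closed a (hdom Q).
Proof.
have /type_definableP[B [sb [b [B_small bX]]]] := hdom_type_definable Q.
apply: (type_closed_invariant K_lim M_sat M_hom Q_small B_small a_small bX).
move=> g ga x; suff gA : fixes A g by move/(hdom_act _ gA).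
by apply/fixesP => j; rewrite ga; apply/hclass_hrel.
Qed.

(* [orbit_graph] is a countable intersection of [a]-definable sets; [near n]
   is the symmetrisation of the intersection of the first [n.+1] of them. *)
Let near_ex : exists near : nat -> set (mtuple M (sort_cat sv sv)),
  [/\ forall n, definable a (near n),
      forall m n, (n <= m)%N -> near m `<=` near n,
      forall n x y, near n (tcat x y) -> near n (tcat y x) &
      forall x y, orbit x y <-> forall n, near n (tcat x y)].
Proof.
have [D DP] := countable_definable (sort_cat sv sv) a L_count
  (countable_sum Q_count Q_count) aidx_count.
(* [D] enumerates all [a]-definable sets; those that do not contain the graph are neutralised. *)
pose D' n := if pselect (orbit_graph `<=` D n) then D n else setT.
have D'_def n : definable a (D' n).
  rewrite /D'; case: pselect => _ /=; last exact: definableT.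
  by apply/DP; exists n.
have D'_orbit n : orbit_graph `<=` D' n by rewrite /D'; case: pselect.
pose flip (z : mtuple M (sort_cat sv sv)) : mtuple M (sort_cat sv sv) :=
  tcat (tright z) (tleft z).
have flip_def E : definable a E -> definable a (flip @^-1` E).
  apply: definable_preimage => -[[v|v]|c].
  - by exists (inl (inr v)), erefl.
  - by exists (inl (inl v)), erefl.
  - by exists (inr c), erefl.
pose near := fix near n := (if n is m.+1 then near m else setT) `&`
  (D' n `&` flip @^-1` D' n).
have nearS n : near n.+1 `<=` near n by move=> z [].
have nearD n : near n `<=` D' n by case: n => [|n] z [_ []].
exists near; split.
- elim=> [|n IH] /=; apply: definableI => //; try exact: definableT;
    by apply: definableI => //; exact: flip_def.
- move=> m n /subnK <-; elim: (m - n)%N => // k IH z; rewrite addSn => /nearS.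
  exact: IH.
- elim=> [|n IH] x y /= [xy [Dxy Dyx]]; split=> //.
  exact: IH.
- move=> x y; split=> [xy n|xy]; last first.
    suff : orbit_graph (tcat x y) by [].
    apply: orbit_graph_closed => E /DP[n _ <-] orbitD.
    by have := nearD n _ (xy n); rewrite /D'; case: pselect.
  have D'xy k : D' k (tcat x y) by apply: D'_orbit.
  have D'yx k : D' k (tcat y x) by apply: D'_orbit; exact: orbit_sym.
  by elim: n => [|n IH] /=; split.
Qed.

Let near : nat -> set (mtuple M (sort_cat sv sv)) := projT1 (cid near_ex).

Let near_def n : definable a (near n).
Proof. by rewrite /near; case: cid => ? []. Qed.

Let near_mono m n : (n <= m)%N -> near m `<=` near n.
Proof. by rewrite /near; case: cid => r [? h ? ?]; exact: h. Qed.

Let near_sym n x y : near n (tcat x y) -> near n (tcat y x).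
Proof. by rewrite /near; case: cid => r [? ? h ?]; exact: h. Qed.

Let orbit_near x y : orbit x y <-> forall n, near n (tcat x y).
Proof. by rewrite /near; case: cid => r [? ? ? h]; exact: h. Qed.

(** If the three steps are near at every level, transitivity of [orbit] makes the ends near at level
    [n]; compactness finds one level that suffices. *)
Let near_trans3 n : exists2 m, (n < m)%N & forall x y z w,
  near m (tcat x y) -> near m (tcat y z) -> near m (tcat z w) -> near n (tcat x w).
Proof.
pose W := sort_cat (sort_cat sv sv) (sort_cat sv sv).
have vv_small := small_sum K_lim Q_small Q_small.
pose tr (m : nat) : set (mtuple M W) :=
  [set u | near m (tleft u)] `&`
  ([set u | near m (tcat (tright (tleft u)) (tleft (tright u)))] `&`
   [set u | near m (tright u)]).
pose C : set (mtuple M W) :=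
  [set u | near n (tcat (tleft (tleft u)) (tright (tright u)))].
have tr_mono m k : (k <= m)%N -> tr m `<=` tr k.
  by move=> km u [u1 [u2 u3]]; do !split; apply: near_mono km _ _.
have [m|m k||u uP|m mC] := compactness_decreasing (D := tr) (C := C) (b := a)
    K_lim M_sat (small_sum K_lim vv_small vv_small) a_small.
- apply: definableI; last apply: definableI.
  + apply: (definable_preimage (p := a) (f := fun u : mtuple M W => tleft u)
      (D := near m)) => // -[v|c].
      by exists (inl (inl v)), erefl.
    by exists (inr c), erefl.
  + apply: (definable_preimage (p := a)
      (f := fun u : mtuple M W => tcat (tright (tleft u)) (tleft (tright u)))
      (D := near m)) => // -[[v|v]|c].
    * by exists (inl (inl (inr v))), erefl.
    * by exists (inl (inr (inl v))), erefl.
    * by exists (inr c), erefl.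
  + apply: (definable_preimage (p := a) (f := fun u : mtuple M W => tright u)
      (D := near m)) => // -[v|c].
      by exists (inl (inr v)), erefl.
    by exists (inr c), erefl.
- exact: tr_mono.
- apply: (definable_preimage (p := a)
    (f := fun u : mtuple M W => tcat (tleft (tleft u)) (tright (tright u)))
    (D := near n)) => // -[[v|v]|c].
  + by exists (inl (inl (inl v))), erefl.
  + by exists (inl (inr (inr v))), erefl.
  + by exists (inr c), erefl.
- have uE : tcat (tleft (tleft u)) (tright (tleft u)) = tleft u by exact: tcatE.
  have uE' : tcat (tleft (tright u)) (tright (tright u)) = tright u by exact: tcatE.
  suff xw : orbit (tleft (tleft u)) (tright (tright u)) by exact: (orbit_near _ _).1 xw n.
  apply: (@orbit_trans _ (tright (tleft u))).
    by apply/orbit_near => m; rewrite uE; have [] := uP m.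
  apply: (@orbit_trans _ (tleft (tright u))).
    by apply/orbit_near => m; have [_ []] := uP m.
  by apply/orbit_near => m; rewrite uE'; have [_ []] := uP m.
(* The level is pushed above [n] so that its iterates are unbounded. *)
exists (maxn n.+1 m); first exact: leq_maxl.
move=> x y z w xy yz zw; suff /(tr_mono _ m (leq_maxr _ _))/mC :
  tr (maxn n.+1 m) (tcat (tcat x y) (tcat z w)) by [].
by split.
Qed.

(** By homogeneity, points with the type of [x] over [a] are in its orbit, hence near [x]; by
    compactness one set from this type suffices. *)
Let near_type x n : hdom Q x -> exists theta : set (mtuple M sv),
  [/\ definable a theta, theta x & forall y, theta y -> near n (tcat x y)].
Proof.
move=> Xx; have near_def' : definable (tcat x a) [set y | near n (tcat x y)].
  apply: (definable_preimage (p := a) (f := fun y => tcat x y)) => // -[[v|v]|c].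
  + by exists (inr (inl v)), erefl.
  + by exists (inl v), erefl.
  + by exists (inr (inr c)), erefl.
have [E [aE _]|E F [aE Ex] [aF Fx]|||y yP|theta [a_theta theta_x] thetaP] :=
  compactness_subset (b := tcat x a) (F := [set E | definable a E /\ E x])
    (C := [set y | near n (tcat x y)]) K_lim M_sat Q_small
    (small_sum K_lim Q_small a_small).
- apply: (definable_preimage (p := a) (f := id)) aE => -[v|c].
  + by exists (inl v), erefl.
  + by exists (inr (inr c)), erefl.
- by split=> //; exact: definableI.
- by exists setT; split=> //; exact: definableT.
- exact: near_def'.
- apply: (orbit_near x y).1.
  have xy (phi : formula (sort_cat sv sa)) : sat phi (tcat x a) <-> sat phi (tcat y a).
    split=> [xphi|].
      by apply: (yP [set z | sat phi (tcat z a)]); split; [exists phi|].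
    apply: contraPP => xphi yphi.
    suff /(_ yphi) : (~` [set z | sat phi (tcat z a)]) y by [].
    by apply: yP; split=> //; apply: definableC; exists phi.
  have [g] := M_hom (small_sum K_lim Q_small a_small) xy.
  rewrite act_tcat => /tcat_inj[gx ga]; exists g.
    by apply/fixesP => j; rewrite ga; apply/hclass_hrel.
  have gA : fixes A g by apply/fixesP => j; rewrite ga; apply/hclass_hrel.
  by rewrite gx; apply: hrel_refl; rewrite -gx; apply/hdom_act.
- by exists theta; split.
Qed.

(** Otherwise compactness gives a point of [F] near [x] at all levels, hence in the orbit of [x],
    and the invariance of [F] puts [p] in [F]. *)
Let closed_separated (F : set Q) (p : Q) x : bw_definable A F -> ~ F p ->
  hclass p x -> exists n, forall y, hpreim F y -> ~ near n (tcat x y).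
Proof.
move=> [/type_definableP[B [sb [b [B_small bF]]]] FA] nFp px.
apply: contrapT => nsep.
pose ba := tcat x (tcat b a).
have near_def' n : definable ba [set y | near n (tcat x y)].
  apply: (definable_preimage (p := a) (f := fun y => tcat x y)) => // -[[v|v]|c].
  + by exists (inr (inl v)), erefl.
  + by exists (inl v), erefl.
  + by exists (inr (inr (inr c))), erefl.
have [_ [D [n [bD FD ->]]]|_ _ [D [m [bD FD ->]]] [E [n [bE FE ->]]]|
  |_ [D [n [bD FD ->]]]|y yP] :=
  @compactness _ _ _ K_lim M_sat _ _ sv _ ba
    [set C | exists D n, [/\ definable b D, hpreim F `<=` D &
                            C = D `&` [set y | near n (tcat x y)]]]
    Q_small (small_sum K_lim Q_small (small_sum K_lim B_small a_small)).
- apply: definableI => //; apply: (definable_preimage (p := b) (f := id)) bD.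
  by case=> [v|c]; [exists (inl v)|exists (inr (inr (inl c)))]; exists erefl.
- exists (D `&` E), (maxn m n); split; first exact: definableI.
    by move=> z Fz; split; [exact: FD|exact: FE].
  rewrite setIACA; congr (_ `&` _); apply/seteqP; split=> [z [zm zn]|z zmn].
    by rewrite /=; case: (leqP m n).
  by split; apply: near_mono zmn; rewrite ?leq_maxl ?leq_maxr.
- exists (setT `&` [set y | near 0 (tcat x y)]), setT, 0%N.
  by split=> //; exact: definableT.
- apply: contrapT => empty; apply: nsep; exists n => y Fy xy.
  by apply: empty; exists y; split=> //; exact: FD.
have Fy : hpreim F y.
  apply: bF => D bD FD; suff [] : (D `&` [set y | near 0 (tcat x y)]) y by [].
  by apply: yP; exists D, 0%N.
have [g gA gxy] : orbit x y.
  apply/orbit_near => n; suff [] : (setT `&` [set y | near n (tcat x y)]) y by [].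
  by apply: yP; exists setT, n; split=> //; exact: definableT.
apply: nFp; apply/(hpreimE _ px); apply/((aut_invariantP _ _).1 FA g gA).
have [q Fq qy] := Fy; exists q => //.
by apply/(hclass_hrel _ qy); exact: hrel_sym.
Qed.

(** If [x] lies in every [a]-definable superset of the preimage of [F], the sets of [near_type]
    around [x] meet it at every level, so [x] belongs to it. Invariance holds because points of one
    orbit are near at every level. *)
Let separated_closed (F : set Q) :
  (forall x, hdom Q x ->
    (forall n, exists2 y, hpreim F y & near n (tcat x y)) -> hpreim F x) ->
  bw_definable A F.
Proof.
move=> FP; split.
  apply/type_definableP; exists aidx, sa, a; split=> // x xF.
  have Xx : hdom Q x.
    apply: hdom_closed => D aD XD; apply: xF => // y [p _ /hclass_dom].
    exact: XD.
  apply: FP => // n; apply: contrapT => nF.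
  have [theta [a_theta theta_x thetaP]] := near_type n Xx.
  suff : (~` theta) x by [].
  apply: xF => [|y Fy theta_y]; first exact: definableC.
  by apply: nF; exists y => //; exact: thetaP.
have stable x y : orbit x y -> hpreim F x -> hpreim F y.
  move=> xy Fx; apply: FP => [|n]; first by have [] := orbit_hdom xy.
  by exists x => //; apply: (orbit_near y x).1; exact: orbit_sym.
apply/aut_invariantP => g gA x; split=> Fx.
  have Xx : hdom Q x.
    by apply/(hdom_act x gA); have [p _ /hclass_dom] := Fx.
  apply: (stable _ _ _ Fx); apply: orbit_sym; exists g => //.
  by apply: hrel_refl; apply/(hdom_act _ gA).
apply: (stable _ _ _ Fx); exists g => //; apply: hrel_refl; apply/(hdom_act _ gA).
by have [p _ /hclass_dom] := Fx.
Qed.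

Lemma pseudo_metrisable_countable (R : realType) :
  pseudo_metrisable R (piece_logic_closed A Q).
Proof.
have m_ex n : exists m, (n < m)%N /\ forall x y z w,
    near m (tcat x y) -> near m (tcat y z) -> near m (tcat z w) -> near n (tcat x w).
  by have [m ? ?] := near_trans3 n; exists m.
have [m mP] := choice m_ex.
(* Passing to the levels [k n] makes three steps of index [n.+1] compose to one of index [n], as the
   chain metric requires. *)
pose k n := iter n m 0%N.
have kn n : (n <= k n)%N.
  elim: n => // n IH; rewrite /k iterS -/(k n).
  by apply: leq_ltn_trans IH _; have [] := mP (k n).
pose rep (p : Q) : mtuple M sv := projT1 (cid (hclass_nonempty p)).
have rep_class p : hclass p (rep p) by rewrite /rep; case: cid.
pose U n p q := near (k n) (tcat (rep p) (rep q)).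
have [||n p q r s|d d_pm [Ud dU]] := @pseudo_metric_of_entourages R Q U.
- move=> n p; apply: (orbit_near _ _).1; apply: orbit_refl.
  exact: hclass_dom (rep_class p).
- by move=> n p q; exact: near_sym.
- by rewrite /U /k iterS -/(k n); have [_] := mP (k n); apply.
apply/pseudo_metrisableP; exists d => // F; split=> [FA p nFp|FP].
  have [n nP] := closed_separated FA nFp (rep_class p).
  have [e e0 eU] := dU n; exists e => // q Fq.
  rewrite Order.TotalTheory.leNgt; apply/negP => /eU /(near_mono (kn n)).
  by apply: nP; exists q.
apply: separated_closed => x Xx xF; have [p px _] := hclass_of Xx.
apply/(hpreimE _ px); apply: contrapT => /FP[e e0 eF].
have [n nU] := Ud e e0.
have [y [q Fq qy] xy] := xF (k n.+1).
(* [U] compares chosen representatives. Elements of one class are near at all levels, so [rep p],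
   [x], [y], [rep q] are joined by three steps at level [k n.+1]. *)
have pq : U n p q.
  have [_] := mP (k n); apply; last 2 first.
  - exact: xy.
  - apply: (orbit_near _ _).1; exists (aut_id M) => //.
    by apply/(hclass_hrel _ qy).
  apply: (orbit_near _ _).1; exists (aut_id M) => //.
  by apply/(hclass_hrel _ (rep_class p)).
by have := nU p q pq; rewrite Order.TotalTheory.ltNge eF.
Qed.

End CountablePiece.

Theorem theorem1p50 (R : realType) (K : Type) (L : language) (M : structure L)
  (K_strong_limit : strong_limit K) (L_small : language_small K L)
  (M_saturated : saturated K M) (M_homogeneous : strongly_homogeneous K M)
  (J : Type) (A : J -> hyperimaginary K M) (A_small : small K [set: J])
  (P : piecewise_hyperdefinable A)
  (P_local : locally_hyperdefinable P) (P_cof : countable_cofinality P) :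
  (pseudo_metrisable R (logic_closed P) <->
    forall i : pw_index P, pseudo_metrisable R (piece_logic_closed A (piece P i)))
  /\
  (language_countable L ->
   countable [set: J] ->
   (forall j : J, countable [set: arity (hi_set (A j))]) ->
   (forall i : pw_index P, countable [set: arity (piece P i)]) ->
   pseudo_metrisable R (logic_closed P)).
Proof.
split=> [|L_count J_count A_count P_count].
  split=> [P_met i|]; first exact: pseudo_metrisable_piece.
  exact: pseudo_metrisable_limit.
apply: pseudo_metrisable_limit => // i.
(* The summand [nat] in [language_small] makes the saturation cardinal uncountable, so countable
   tuples are small. *)
have K_nat : small K [set: nat] by apply: (small_inj (f := inr)) L_small => m n [].
apply: pseudo_metrisable_countable => //; exact: piece_over.
Qed.
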